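(* Let $\Omega \subset \mathbb{R}^d$ be a bounded domain with smooth boundary, let $A \in C^1(\mathbb{R}^d, \mathbb{R}^d)$, let $V \in C^1(\mathbb{R}^d, \mathbb{R}_{\geq 0})$, and let $\phi \not\equiv 0$ be an eigenfunction with eigenvalue $\lambda$, that is, a solution of $$\frac{1}{2}\left(-i\nabla - A(x)\right)^2 \phi(x) + V(x)\phi(x) = \lambda \phi(x) \quad \text{in } \Omega$$ subject to Dirichlet boundary conditions $\phi = 0$ on $\partial\Omega$. Then, for all $x \in \Omega$ and all $t > 0$, $$\frac{|\phi(x)|}{\|\phi\|_{L^\infty(\Omega)}} \leq \mathbb{E}_{\omega}\left(\chi_{\Omega}(\omega_{x}, t) \exp\left(\lambda \cdot t - \int_0^t V(\omega_{x}(s))\, ds\right)\right),$$ where the expectation is taken with respect to Brownian motion $\omega_x(s)$ started at $\omega_x(0) = x$ and running for $t$ units of time, and $$\chi_{\Omega}(\omega,t) = \begin{cases} 1 & \text{if } \omega(s) \in \Omega \text{ for all } 0 \leq s \leq t,\\ 0 & \text{otherwise.}\end{cases}$$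
   Context: The operator $\frac12(-i\nabla - A)^2 + V$ with Dirichlet boundary conditions is the (self-adjoint) magnetic Schrödinger operator on $\Omega$; its eigenvalues $\lambda$ are real, and eigenfunctions $\phi$ are complex-valued. Brownian motion is standard $d$-dimensional Brownian motion (infinitesimal generator $\frac12\Delta$). *)

(* Defs.v *)
From HB Require Import structures.
From mathcomp Require Export all_boot all_order all_algebra.
From mathcomp Require Export all_classical all_reals all_analysis.
From mathcomp Require Export complex.
Set Implicit Arguments.
Unset Strict Implicit.
Unset Printing Implicit Defensive.
Import Order.TTheory GRing.Theory Num.Theory.
Import numFieldNormedType.Exports.
Local Open Scope classical_set_scope.
Local Open Scope ring_scope.

Section calculus.
Variables (R : realType) (d : nat).
Implicit Types (U : set 'rV[R]_d) (f : 'rV[R]_d -> R) (j : 'I_d).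

Definition evec j : 'rV[R]_d := delta_mx 0 j.

Definition partial j f (x : 'rV[R]_d) : R := 'D_(evec j) f x.

(* Meaningful for open U only: continuity and derivability are those of f
   on a full neighbourhood of each point of U. *)
Fixpoint Ck (k : nat) U f : Prop :=
  {in U, continuous f} /\
  (if k is k'.+1 then
     forall j, (forall x, U x -> derivable f x (evec j)) /\
               Ck k' U (partial j f)
   else True).

Definition smooth_on U f : Prop := forall k, Ck k U f.

Definition boundary U : set 'rV[R]_d := closure U `\` interior U.

Definition domain U : Prop := [/\ U !=set0, open U & connected U].

(* Near each boundary point, U is the negativity set of a smooth function
   whose gradient does not vanish (a local defining function). *)
Definition smooth_boundary U : Prop :=
  forall p, boundary U p ->
    exists N : set 'rV[R]_d, exists rho : 'rV[R]_d -> R,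
      [/\ open N, N p, smooth_on N rho,
          (forall x, N x -> exists j, partial j rho x != 0) &
          forall x, N x -> (U x <-> rho x < 0)].

(* Lebesgue null sets: covered by countably many closed boxes of arbitrarily
   small total volume. *)
Definition null_set (N : set 'rV[R]_d) : Prop :=
  forall e : R, 0 < e ->
    exists a b : nat -> 'rV[R]_d,
      [/\ (forall n j, a n 0 j <= b n 0 j),
          N `<=` \bigcup_n [set x | forall j, a n 0 j <= x 0 j <= b n 0 j] &
          (\sum_(0 <= n <oo) (\prod_(j < d) (b n 0 j - a n 0 j))%:E <= e%:E)%E].

End calculus.

Section magnetic.
Variables (R : realType) (d : nat).
Implicit Types (Omega : set 'rV[R]_d) (A : 'rV[R]_d -> 'rV[R]_d)
  (V : 'rV[R]_d -> R) (phi : 'rV[R]_d -> R[i]) (j : 'I_d).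

Definition cre phi (x : 'rV[R]_d) : R := complex.Re (phi x).
Definition cim phi (x : 'rV[R]_d) : R := complex.Im (phi x).

Definition cabs (z : R[i]) : R := ComplexField.Normc.normc z.

Definition cpartial j phi (x : 'rV[R]_d) : R[i] :=
  Complex (partial j (cre phi) x) (partial j (cim phi) x).

(* j-th component of (- i nabla - A) phi *)
Definition momentum A j phi (x : 'rV[R]_d) : R[i] :=
  - (Complex 0 1 * cpartial j phi x) - (A x 0 j)%:C%C * phi x.

(* (1/2) (- i nabla - A)^2 phi + V phi *)
Definition magnetic_schrodinger A V phi (x : 'rV[R]_d) : R[i] :=
  2%:R^-1 * (\sum_(j < d) momentum A j (momentum A j phi) x)
  + (V x)%:C%C * phi x.

(* Classical solution of the Dirichlet eigenvalue equation. Only the values of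
   phi on the closure of Omega are constrained. *)
Record dirichlet_eigenfunction Omega A V (lambda : R) phi : Prop := {
  ef_C2_re : Ck 2 Omega (cre phi);
  ef_C2_im : Ck 2 Omega (cim phi);
  ef_continuous_re : {within closure Omega, continuous (cre phi)};
  ef_continuous_im : {within closure Omega, continuous (cim phi)};
  ef_equation : forall x, Omega x ->
    magnetic_schrodinger A V phi x = lambda%:C%C * phi x;
  ef_boundary : forall x, boundary Omega x -> phi x = 0;
  ef_nonzero : exists2 x, Omega x & phi x != 0 }.

(* Essential supremum of |phi| over Omega for the Lebesgue measure of R^d. *)
Definition Linfty_norm Omega phi : \bar R :=
  ereal_inf [set M%:E | M in
    [set M : R | 0 <= M /\ null_set (Omega `&` [set x | M < cabs (phi x)])]].

End magnetic.

Section brownian.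
Variables (R : realType) (d : nat) (disp : measure_display)
  (T : measurableType disp) (P : probability T R).

(* For a finite family, the product rule for all Borel sets B i (taking some of
   them to be setT gives the rule for subfamilies). *)
Definition mutually_independent (I : finType) (X : I -> T -> R) : Prop :=
  forall B : I -> set R, (forall i, measurable (B i)) ->
    P [set w | forall i, B i (X i w)] = (\prod_(i : I) P (X i @^-1` B i))%E.

(* Standard d-dimensional Brownian motion started at x, with continuous paths;
   time is t : R and only t >= 0 is constrained. The increments along a
   partition are independent both across time steps and across coordinates. *)
Record brownian_motion (x : 'rV[R]_d) (W : R -> T -> 'rV[R]_d) : Prop := {
  bm_measurable : forall t (j : 'I_d), 0 <= t ->
    measurable_fun [set: T] (fun w => W t w 0 j);
  bm_start : forall w, W 0 w = x;
  bm_continuous : forall w, {within `[0, +oo[, continuous (fun t => W t w)};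
  bm_independent : forall (n : nat) (t : nat -> R),
    0 <= t 0%N -> (forall k, (k < n)%N -> t k < t k.+1) ->
    mutually_independent (fun (kj : 'I_n * 'I_d) (w : T) =>
      W (t kj.1.+1) w 0 kj.2 - W (t kj.1) w 0 kj.2);
  bm_gaussian : forall (s t : R) (j : 'I_d), 0 <= s -> s < t ->
    forall B : set R, measurable B ->
    P [set w | B (W t w 0 j - W s w 0 j)] = normal_prob 0 (Num.sqrt (t - s)) B }.

End brownian.

Definition chi (R : realType) (d : nat) (Omega : set 'rV[R]_d)
    (w : R -> 'rV[R]_d) (t : R) : R :=
  if `[< forall s, 0 <= s <= t -> Omega (w s) >] then 1 else 0.

(* Main.v *)
From HB Require Import structures.
Require Import Defs.
From mathcomp Require Import ring lra measurable_realfun.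
Import Order.TTheory GRing.Theory Num.Theory.
Import numFieldNormedType.Exports.
Local Open Scope classical_set_scope.
Local Open Scope ring_scope.
Set Implicit Arguments.
Unset Strict Implicit.
Unset Printing Implicit Defensive.

(** Let [u = |phi|]. Kato's inequality (diamagnetism) says that the vector
    potential can only help: where [phi] does not vanish,
    [(V - lambda) u <= (1/2) Laplacian u] ([kato_inequality]). So [u] is a subsolution of the heat equation with
    potential [V - lambda], and along Brownian paths
    [u (W s) exp (lambda s - int_0^s V (W r) dr)] increases on average until the
    path leaves [Omega], where [u] vanishes. Hence [u x] is at most the
    expectation of this quantity at time [t] on the paths that survive, and
    [u (W t) <= ||phi||_oo] almost surely because the law of [W t] has a density.

    Three points need care: [u] is neither smooth nor a subsolution beyond
    [Omega], the argument is carried out without stochastic integrals, and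
    the bound on [u] holds only off a Lebesgue null set.

    Smoothness. For [dl > 0] the function [g = shrink dl u], a convex increasing
    [C^2] function of [u > 0] that vanishes for [u <= dl], extends by [0] to a
    [C^2] function on the whole space. Its support lies in the level set [K] of the
    points of [Omega] where [u >= dl]; since [phi] vanishes on the boundary and
    is continuous up to it, [K] is a compact subset of [Omega]. Convexity
    preserves the differential inequality up to an error proportional to [dl]
    ([truncated_eigenfunction_subsolution]).

    The average increase. Sample the path on a grid of mesh [h = t / N] and kill it
    at the first grid time outside [K]. The Gaussian increment of one step is
    performed coordinate by coordinate, so that a second order expansion only
    involves pure second derivatives, at points independent of the coordinate
    that is about to move: the first order terms average to [0] and the second
    order ones to [(h / 2) Laplacian g], up to [o(h)] ([one_step_lower_bound]).
    The weight [exp (h (lambda - V))] compensates this drift, and summing over the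
    [N] steps gives [grid_walk_lower_bound]. As [N] grows, the weights converge
    path by path, by convergence of Riemann sums and because a path that leaves
    the closed set [K] does so during a time interval seen by a fine grid;
    dominated convergence then gives [feynman_kac_inequality].

    Null sets. A set covered by boxes of small total volume is hit by [W t] with
    small probability, the Gaussian density being bounded ([brownian_null_set]).
    Letting [dl] and this probability tend to [0] gives
    [eigenfunction_le_essential_bound], and the essential supremum is the infimum
    of the bounds [M] allowed there. *)

(** * Independence from the other variables of a family *)

Section independence.
Context {disp : measure_display} {T : measurableType disp} {R : realType}.
Variable P : probability T R.

(** A pi-system generating the sigma-algebra of the variables other than
    [X i0]. *)
Definition generated_without (I : finType) (X : I -> T -> R) (i0 : I) :
    set (set T) :=
  [set C | exists B : I -> set R, [/\ forall i, measurable (B i), B i0 = setT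
     & C = [set w | forall i, B i (X i w)]]].

(** As functions of [C], both sides are finite measures; they agree on the
    pi-system [generated_without X i0] by mutual independence. *)
Lemma independent_of_generated (I : finType) (X : I -> T -> R) (i0 : I) :
    (forall i, measurable_fun setT (X i)) -> mutually_independent P X ->
  forall C B, <<s generated_without X i0 >> C -> measurable B ->
  P (C `&` X i0 @^-1` B) = (P C * P (X i0 @^-1` B))%E.
Proof.
move=> mX indX C B sC mB.
set G := generated_without X i0.
have mXB i A : measurable A -> measurable (X i @^-1` A).
  by move=> mA; rewrite -[X in measurable X]setTI; exact: mX.
have mG : G `<=` measurable.
  move=> _ [D [mD _ ->]].
  rewrite [X in measurable X](_ : _ = \bigcap_i (X i @^-1` D i)).
    by apply: fin_bigcap_measurable => // i _; exact: mXB.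
  by apply/seteqP; split=> [w Hw i _|w Hw i]; exact: Hw.
have GI : setI_closed G.
  move=> _ _ [D [mD D0 ->]] [D' [mD' D'0 ->]].
  exists (fun i => D i `&` D' i); split.
  - by move=> i; exact: measurableI.
  - by rewrite D0 D'0 setTI.
  - by apply/seteqP; split=> [w [H1 H2] i|w H]; [split|split=> i; have [] := H i].
have GT : G setT by exists (fun=> setT); split=> //; apply/seteqP; split.
pose p := NngNum (fine_ge0 (measure_ge0 P (X i0 @^-1` B))).
have pE : p%:num%:E = P (X i0 @^-1` B).
  by rewrite /= fineK// fin_num_measure//; apply: mXB.
pose m1 : {measure set T -> \bar R} := mrestr P (mXB i0 B mB).
pose m2 : {measure set T -> \bar R} := mscale p P.
rewrite -[LHS]/(m1 C) muleC -pE -[RHS]/(m2 C).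
apply: (@g_sigma_algebra_measure_unique _ _ _ G mG (fun=> setT) (fun=> GT) _ m1 m2 GI) => //.
- by rewrite bigcup_const.
- move=> _ [D [mD D0 ->]]; rewrite /m1 /m2 /= /mrestr /mscale pE.
  pose D' i := if i == i0 then B else D i.
  have mD' i : measurable (D' i) by rewrite /D'; case: ifP.
  rewrite [X in P X = _](_ : _ = [set w | forall i, D' i (X i w)]); last first.
    apply/seteqP; split=> [w [H1 H2] i|w H].
      by rewrite /D'; case: eqVneq => [->|].
    split=> [i|]; last by have := H i0; rewrite /D' eqxx.
    by have := H i; rewrite /D'; case: eqVneq => [->|//]; rewrite D0.
  transitivity (P (X i0 @^-1` B) * \prod_i P (X i @^-1` D i))%E; last first.
    by congr (_ * _)%E; symmetry; exact: (indX D mD).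
  rewrite (indX _ mD') (bigD1 i0)//= [X in _ = (_ * X)%E](bigD1 i0)//=.
  rewrite D0 preimage_setT probability_setT mul1e {1}/D' eqxx; congr (_ * _)%E.
  by apply: eq_bigr => i /negPf; rewrite /D' => ->.
- by move=> _; rewrite /m1 /= /mrestr setTI ltey_eq fin_num_measure//; exact (mXB i0 B mB).
Qed.

(** Independence makes the law of the pair a product measure, and Fubini's
    theorem then splits the expectation of the product. *)
Lemma expectation_mul_independent (Y Z : T -> R) :
    measurable_fun setT Y -> measurable_fun setT Z ->
    (forall A B, measurable A -> measurable B ->
       P (Y @^-1` A `&` Z @^-1` B) = (P (Y @^-1` A) * P (Z @^-1` B))%E) ->
    P.-integrable setT (EFin \o Y) -> P.-integrable setT (EFin \o Z) ->
  P.-integrable setT (EFin \o (Y \* Z)) /\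
  \int[P]_w (Y w * Z w) = (\int[P]_w Y w) * (\int[P]_w Z w).
Proof.
move=> mY mZ indYZ iY iZ.
pose phi w := (Y w, Z w).
have mphi : measurable_fun setT phi by exact: measurable_fun_pair.
pose Y' : {mfun T >-> R} := HB.pack Y (isMeasurableFun.Build _ _ _ _ _ mY).
pose Z' : {mfun T >-> R} := HB.pack Z (isMeasurableFun.Build _ _ _ _ _ mZ).
pose phi' : {mfun T >-> (R * R)%type} :=
  HB.pack phi (isMeasurableFun.Build _ _ _ _ _ mphi).
pose mu1 : probability R R := distribution P Y'.
pose mu2 : probability R R := distribution P Z'.
pose nu : probability (R * R)%type R := distribution P phi'.
have nuE A : measurable A -> nu A = (mu1 \x mu2)%E A.
  by move=> mA; apply/esym/product_measure_unique => //=.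
pose f0 (z : R * R) := z.1 * z.2.
pose f := EFin \o f0.
have mf : measurable_fun setT f.
  apply/measurable_EFinP.
  by apply: measurable_funM; [exact: measurable_fst|exact: measurable_snd].
have iY' : mu1.-integrable setT EFin.
  by apply: integrable_pushforward.
have iZ' : mu2.-integrable setT EFin.
  by apply: integrable_pushforward.
have if12 : (mu1 \x mu2)%E.-integrable setT f.
  apply/integrable12ltyP => //=.
  under eq_integral => x _.
    under eq_integral => y _ do rewrite /f /f0 /= normrM EFinM.
    rewrite ge0_integralZl//=; last by apply/measurableT_comp.
    over.
  have /integrableP[_ /= zoo] := iZ'.
  have /integrableP[_ /= yoo] := iY'.
  rewrite ge0_integralZr//=; last 2 first.
    by apply: measurableT_comp.
    exact: integral_ge0.
  by rewrite lte_mul_pinfty//; [exact: integral_ge0|rewrite ge0_fin_numE//; exact: integral_ge0].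
have if' : nu.-integrable setT f.
  apply/integrableP; split=> //.
  rewrite (eq_measure_integral (mu1 \x mu2)%E) => [|A mA _]; last exact: nuE.
  by have /integrableP[] := if12.
have iYZ : P.-integrable setT (EFin \o (Y \* Z)).
  apply/integrableP; split; first by apply/measurable_EFinP/measurable_funM.
  move/integrableP : (if') => [_].
  by rewrite ge0_integral_pushforward//; apply: measurableT_comp.
split=> //.
rewrite /Rintegral.
rewrite (_ : (\int[P]_w (Y w * Z w)%:E = \int[nu]_z f z)%E); last first.
  by rewrite integral_pushforward//.
rewrite (eq_measure_integral (mu1 \x mu2)%E) => [|A mA _]; last exact: nuE.
rewrite -integral12_prod_meas1//= /fubini_F.
under eq_integral => x _.
  under eq_integral => y _ do rewrite /f /f0 /= EFinM.
  rewrite integralZl//=.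
  over.
have zfin : (\int[mu2]_y y%:E)%E \is a fin_num by exact: integrable_fin_num.
have yfin : (\int[mu1]_y y%:E)%E \is a fin_num by exact: integrable_fin_num.
rewrite -(fineK zfin) integralZr//= -(fineK yfin) -EFinM /=.
by rewrite !integral_pushforward.
Qed.

Lemma measurable_generated_without (I : finType) (X : I -> T -> R) (i0 i : I) :
    i != i0 ->
  measurable_fun [set: g_sigma_algebraType (generated_without X i0)] (X i).
Proof.
move=> ii0 _ A mA; rewrite setTI; apply: sub_sigma_algebra.
exists (fun k => if k == i then A else setT); split.
- by move=> k; case: ifP.
- by rewrite eq_sym (negPf ii0).
- apply/seteqP; split=> [w Aw k|w /(_ i)]; last by rewrite eqxx.
  by case: eqVneq => // ->.
Qed.

Lemma expectation_mul_generated (I : finType) (X : I -> T -> R) (i0 : I)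
    (Y : T -> R) (f : R -> R) :
    (forall i, measurable_fun setT (X i)) -> mutually_independent P X ->
    measurable_fun setT f -> measurable_fun setT Y ->
    measurable_fun [set: g_sigma_algebraType (generated_without X i0)] Y ->
    P.-integrable setT (EFin \o Y) -> P.-integrable setT (EFin \o (f \o X i0)) ->
  P.-integrable setT (EFin \o (Y \* (f \o X i0))) /\
  \int[P]_w (Y w * f (X i0 w)) = (\int[P]_w Y w) * (\int[P]_w f (X i0 w)).
Proof.
move=> mX indX mf mY mYG iY ifX.
apply: expectation_mul_independent => //.
  by apply: measurableT_comp => //; exact: mX.
move=> A B mA mB; rewrite comp_preimage.
apply: independent_of_generated => //.
  by have := mYG measurableT A mA; rewrite setTI.
by have := mf measurableT B mB; rewrite setTI.
Qed.

End independence.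

(** * Measurability of random vectors given by their coordinates *)

Section vectors.
Context {R : realType} {d : nat}.

Lemma rV_norm_lt (z : 'rV[R]_d) (e : R) : 0 < e ->
  (`|z| < e) = [forall j, `|z 0 j| < e].
Proof.
move=> e0; apply/idP/forallP => [ze j|ze].
  apply: le_lt_trans ze; rewrite [X in _ <= X]mx_normrE.
  by apply: (le_bigmax _ (fun i : 'I_1 * 'I_d => `|z i.1 i.2|) (0, j)).
rewrite [X in X < _]mx_normrE; apply/bigmax_ltP; split=> // -[i j] _ /=.
by rewrite ord1.
Qed.

(** An open set is a countable union of boxes with rational centres. *)
Lemma measurable_preimage_open {disp} {T : measurableType disp}
    (Z : T -> 'rV[R]_d) (U : set 'rV[R]_d) :
    (forall j, measurable_fun setT (fun w => Z w 0 j)) -> open U ->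
  measurable (Z @^-1` U).
Proof.
move=> mZ oU.
pose box (ak : 'rV[rat]_d * nat) :=
  [set z : 'rV[R]_d | forall j, `|z 0 j - ratr (ak.1 0 j)| < ak.2.+1%:R^-1].
pose F ak := if `[< box ak `<=` U >] then Z @^-1` box ak else set0.
rewrite (_ : _ @^-1` _ = \bigcup_ak F ak).
  apply: countable_bigcupT_measurable => // ak; rewrite /F; case: ifP => // _.
  rewrite [X in measurable X](_ : _ = \bigcap_j
      ((fun w => Z w 0 j) @^-1` [set r | `|r - ratr (ak.1 0 j)| < ak.2.+1%:R^-1])).
    apply: fin_bigcap_measurable => // j _.
    rewrite -[X in measurable X]setTI; apply: mZ => //.
    rewrite [X in measurable X](_ : _ = ball (ratr (ak.1 0 j) : R) ak.2.+1%:R^-1).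
      exact: measurable_ball.
    by apply/seteqP; split => r; rewrite /ball /= distrC.
  by apply/seteqP; split=> [w Hw i _|w Hw i]; exact: Hw.
apply/seteqP; split=> [w /= Uw|w [ak _]]; last first.
  by rewrite /F; case: ifPn => // /asboolP; apply.
have /nbhs_ballP[e /= e0 eU] := open_nbhs_nbhs (conj oU Uw).
have [k ke] : exists k : nat, 2 * k.+1%:R^-1 < e.
  have [k _ ke] := near_infty_natSinv_lt (PosNum (divr_gt0 e0 (@ltr0n R 2))).
  exists k; have := ke k (leqnn _); rewrite /= ltr_pdivlMr// mulrC; apply.
have k0 : 0 < k.+1%:R^-1 :> R by rewrite invr_gt0.
set r : R := k.+1%:R^-1 in ke k0.
have /choice[a aE] : forall j, exists q : rat, `|Z w 0 j - ratr q| < r.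
  move=> j; have /rat_in_itvoo[q] : Z w 0 j - r < Z w 0 j + r.
    lra.
  by move=> /itvP qI; exists q; rewrite ltr_distlC !qI.
exists (\row_j a j, k) => //; rewrite /F; case: ifPn => [_|/asboolPn[]].
  by move=> j /=; rewrite mxE.
move=> z zb; apply: eU; rewrite -ball_normE /= rV_norm_lt//.
apply/forallP => j; have := zb j; have := aE j; rewrite /= !mxE !ltr_norml -/r.
lra.
Qed.

Lemma measurable_comp_continuous {disp} {T : measurableType disp}
    (Z : T -> 'rV[R]_d) (f : 'rV[R]_d -> R) :
    (forall j, measurable_fun setT (fun w => Z w 0 j)) -> continuous f ->
  measurable_fun setT (f \o Z).
Proof.
move=> mZ /continuousP cf.
apply: (@measurability _ _ _ _ _ _ (@RGenOpens.G R)).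
  exact: RGenOpens.measurableE.
move=> _ [_ [a [b ->]] <-].
rewrite setTI comp_preimage.
apply: (@measurable_preimage_open _ _ Z (f @^-1` `]a, b[%classic)) => //.
by apply/cf; exact: interval_open.
Qed.

Lemma measurable_preimage_closed {disp} {T : measurableType disp}
    (Z : T -> 'rV[R]_d) (K : set 'rV[R]_d) :
    (forall j, measurable_fun setT (fun w => Z w 0 j)) -> closed K ->
  measurable (Z @^-1` K).
Proof.
move=> mZ cK; rewrite -[K]setCK preimage_setC; apply: measurableC.
by apply: (@measurable_preimage_open _ _ Z (~` K)) => //; exact: closed_openC.
Qed.

End vectors.

(** * Moments of a centred Gaussian variable *)

Section gaussian_density.
Context {R : realType}.
Local Notation mu := (@lebesgue_measure R).

Lemma ge0_integral_normal_prob (s : R) (F : R -> R) :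
    (forall x, 0 <= F x) -> measurable_fun setT F ->
  (\int[normal_prob 0%R s]_x (F x)%:E =
   \int[mu]_x (F x * normal_pdf 0%R s x)%:E)%E.
Proof.
move=> F0 mF.
have dom := @normal_prob_dominates R 0 s.
rewrite -(@Radon_Nikodym_SigmaFinite.change_of_variables _ _ _
  (normal_prob 0 s) mu dom)//=; last exact/measurable_EFinP.
under [RHS]eq_integral do rewrite EFinM.
apply: ae_eq_integral => //.
- apply: emeasurable_funM; first exact/measurable_EFinP.
  apply: (measurable_int mu).
  exact: (Radon_Nikodym_SigmaFinite.f_integrable (nu:=normal_prob 0 s) dom).
- apply: emeasurable_funM; first exact/measurable_EFinP.
  by apply: measurableT_comp => //; exact: measurable_normal_pdf.
- apply: ae_eqe_mul2l.
  apply: integral_ae_eq => //.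
  + exact: Radon_Nikodym_SigmaFinite.f_integrable.
  + by apply: measurableT_comp => //; exact: measurable_normal_pdf.
  + by move=> E _ mE; rewrite -Radon_Nikodym_SigmaFinite.f_integral.
Qed.

End gaussian_density.

Section real_integrable.
Context {disp : measure_display} {T : measurableType disp} {R : realType}.
Variable P : probability T R.
Implicit Types f g : T -> R.

Lemma Rintegrable_scale k f : P.-integrable setT (EFin \o f) ->
  P.-integrable setT (EFin \o (fun w => k * f w)).
Proof. by move=> fi; exact (integrableZl measurableT k fi). Qed.

Lemma Rintegrable_add f g : P.-integrable setT (EFin \o f) ->
  P.-integrable setT (EFin \o g) -> P.-integrable setT (EFin \o (fun w => f w + g w)).
Proof. by move=> fi gi; exact (integrableD measurableT fi gi). Qed.

Lemma Rintegrable_cst (c : R) : P.-integrable setT (EFin \o (fun=> c)).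
Proof. exact: finite_measure_integrable_cst. Qed.

Lemma Rintegral_prob_cst (c : R) : \int[P]_w c = c.
Proof.
rewrite Rintegral_cst// -[RHS]mulr1; congr (_ * _).
by rewrite -[RHS]/(fine 1%:E); congr fine; exact: probability_setT.
Qed.

Lemma Rintegrable_le f g : measurable_fun setT f -> (forall w, `|f w| <= g w) ->
  P.-integrable setT (EFin \o g) -> P.-integrable setT (EFin \o f).
Proof.
move=> mf fg ig; apply: le_integrable ig => //; first exact/measurable_EFinP.
by move=> w _ /=; rewrite lee_fin (le_trans (fg w))// ler_norm.
Qed.

Lemma Rintegrable_sum (I : Type) (r : seq I) (F : I -> T -> R) :
    (forall i, P.-integrable setT (EFin \o F i)) ->
  P.-integrable setT (EFin \o (fun w => \sum_(i <- r) F i w)).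
Proof.
move=> iF; elim: r => [|i r IH].
  apply: eq_integrable (Rintegrable_cst 0) => // w _ /=.
  by rewrite big_nil.
apply: eq_integrable (Rintegrable_add (iF i) IH) => // w _ /=.
by rewrite big_cons.
Qed.

Lemma Rintegral_sum (I : Type) (r : seq I) (F : I -> T -> R) :
    (forall i, P.-integrable setT (EFin \o F i)) ->
  \int[P]_w (\sum_(i <- r) F i w) = \sum_(i <- r) \int[P]_w F i w.
Proof.
move=> iF; elim: r => [|i r IH].
  rewrite big_nil; under eq_Rintegral do rewrite big_nil.
  exact: Rintegral_prob_cst.
under eq_Rintegral do rewrite big_cons.
by rewrite RintegralD// ?IH ?big_cons//; exact: Rintegrable_sum.
Qed.

End real_integrable.

Section gaussian_variable.
Context {disp : measure_display} {T : measurableType disp} {R : realType}.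
Variables (P : probability T R) (s : R) (s_gt0 : 0 < s) (xi : T -> R).
Hypothesis mxi : measurable_fun setT xi.
Hypothesis xi_law : forall B : set R, measurable B ->
  P [set w | B (xi w)] = normal_prob 0 s B.

(** If multiplying the density by [F] yields [k] times another Gaussian density,
    the expectation of [F] is [k]; completing a square provides such an [F] for
    linear and quadratic exponents. All the moments below are deduced from these
    exponential ones by elementary inequalities, without integration by parts. *)
Let integral_tilt (F : R -> R) (k m sg : R) :
    (forall x, 0 <= F x) -> measurable_fun setT F -> 0 <= k ->
    (forall x, F x * normal_pdf 0 s x = k * normal_pdf m sg x) ->
  P.-integrable setT (EFin \o (F \o xi)) /\ \int[P]_w F (xi w) = k.
Proof.
move=> F0 mF k0 Fk.
have E : (\int[P]_w (F (xi w))%:E = k%:E)%E.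
  pose xi' : T -> measurableTypeR R := xi.
  have mxi' : measurable_fun setT xi' by exact: mxi.
  transitivity (\int[pushforward P xi']_x (F x)%:E)%E.
    rewrite ge0_integral_pushforward//; first exact/measurable_EFinP.
    by move=> x _; rewrite lee_fin.
  transitivity (\int[normal_prob 0%R s]_x (F x)%:E)%E.
    by apply: eq_measure_integral => A mA _; exact: xi_law.
  rewrite ge0_integral_normal_prob//.
  under eq_integral do rewrite Fk EFinM.
  rewrite integralZl//; last exact: integrable_normal_pdf.
  by rewrite integral_normal_pdf mule1.
split; last by rewrite /Rintegral E.
apply/integrableP; split; first by apply/measurable_EFinP/measurableT_comp.
under eq_integral do rewrite /= ger0_norm//.
by rewrite /= E ltry.
Qed.

Let s_neq0 : s != 0. Proof. by rewrite gt_eqF. Qed.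

Lemma gaussian_exp_moment (a : R) :
  P.-integrable setT (EFin \o (fun w => expR (a * xi w))) /\
  \int[P]_w expR (a * xi w) = expR (a ^+ 2 * s ^+ 2 / 2).
Proof.
apply: (@integral_tilt (fun x => expR (a * x)) _ (a * s ^+ 2) s) => //.
  by apply: measurableT_comp => //; exact: measurable_funM.
move=> x; rewrite !normal_pdfE// mulrCA [RHS]mulrCA; congr (_ * _).
rewrite -!expRD; congr expR.
by rewrite -mulr_natr; field.
Qed.

Lemma gaussian_square_exp_moment (sg c : R) : 0 < sg ->
    c = (s ^- 2 - sg ^- 2) / 2 ->
  P.-integrable setT (EFin \o (fun w => expR (c * xi w ^+ 2))) /\
  \int[P]_w expR (c * xi w ^+ 2) = sg / s.
Proof.
move=> sg0 cE.
have sgn0 : sg != 0 by rewrite gt_eqF.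
apply: (@integral_tilt (fun x => expR (c * x ^+ 2)) _ 0 sg) => //.
- by apply: measurableT_comp => //; exact: measurable_funM.
- by rewrite divr_ge0// ltW.
move=> x; rewrite !normal_pdfE// /normal_fun mulrCA -expRD.
rewrite (_ : c * _ + _ = - (x - 0) ^+ 2 / (sg ^+ 2 *+ 2)).
  rewrite mulrA; congr (_ * _); rewrite /normal_peak.
  have pk r : 0 < r -> Num.sqrt (r ^+ 2 * pi *+ 2) = r * Num.sqrt (pi *+ 2).
    by move=> r0; rewrite -mulrnAr sqrtrM ?sqr_ge0// sqrtr_sqr gtr0_norm.
  rewrite !pk//; field; rewrite s_neq0 sgn0 /= sqrtr_eq0 -ltNge.
  by rewrite mulrn_wgt0// pi_gt0.
by rewrite cE -[sg ^+ 2 *+ 2]mulr_natr -[s ^+ 2 *+ 2]mulr_natr; field; rewrite s_neq0 sgn0.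
Qed.

(** With [sg = 2 s] the exponential moment is [2], and [y ^ 2 <= 2 exp y] with
    [y = 3 xi ^ 2 / (8 s ^ 2)] bounds [xi ^ 4] by [(128 / 9) s ^ 4 exp y], whence
    the constant [30 = 2 * 15]. *)
Lemma gaussian_fourth_moment :
  P.-integrable setT (EFin \o (fun w => xi w ^+ 4)) /\
  \int[P]_w (xi w ^+ 4) <= 30 * s ^+ 4.
Proof.
have s2 : 0 < 2 * s by rewrite mulr_gt0.
pose c := 3 / 8 / s ^+ 2.
have [|iE EE] := @gaussian_square_exp_moment _ c s2.
  by rewrite /c; field.
have cE : c = 3 / 8 / s ^+ 2 by [].
have c0 : 0 < c by rewrite cE divr_gt0// exprn_gt0.
have le4 w : xi w ^+ 4 <= 15 * s ^+ 4 * expR (c * xi w ^+ 2).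
  have y0 : 0 <= c * xi w ^+ 2 by rewrite mulr_ge0 ?sqr_ge0// ltW.
  have := expR_ge1Dxn 1 y0; set E := expR _ => y1.
  have {y1} y2 : (c * xi w ^+ 2) ^+ 2 <= 2 * E by move: y1; rewrite -[2`!]/2%N; lra.
  have -> : xi w ^+ 4 = s ^+ 4 * (64 / 9) * (c * xi w ^+ 2) ^+ 2 by rewrite cE; field.
  have s40 : 0 < s ^+ 4 by rewrite exprn_gt0.
  have E0 : 0 < E by exact: expR_gt0.
  apply: (@le_trans _ _ (s ^+ 4 * (64 / 9) * (2 * E))).
    by rewrite ler_pM2l// mulr_gt0.
  have := mulr_gt0 s40 E0; rewrite -!mulrA [_ * (2 * E)]mulrA; lra.
have n4 w : `|xi w ^+ 4| = xi w ^+ 4.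
  by rewrite ger0_norm// (_ : 4 = 2 * 2)%N// exprM sqr_ge0.
have iE15 := Rintegrable_scale (15 * s ^+ 4) iE.
have i4 : P.-integrable setT (EFin \o (fun w => xi w ^+ 4)).
  by apply: Rintegrable_le iE15 => [|w]; [exact: measurable_funX|rewrite n4].
split=> //.
have -> : 30 * s ^+ 4 = \int[P]_w (15 * s ^+ 4 * expR (c * xi w ^+ 2)).
  by rewrite RintegralZl// EE; field.
exact: le_Rintegral.
Qed.

Lemma gaussian_square_integrable :
  P.-integrable setT (EFin \o (fun w => xi w ^+ 2)).
Proof.
apply: Rintegrable_le (Rintegrable_add (Rintegrable_cst P 1) gaussian_fourth_moment.1).
  exact: measurable_funX.
move=> w; rewrite ger0_norm ?sqr_ge0// (_ : 4 = 2 * 2)%N// exprM.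
have := sqr_ge0 (xi w); set y := xi w ^+ 2 => y0.
have := sqr_ge0 (y - 1); rewrite sqrrB; nra.
Qed.

Lemma gaussian_integrable : P.-integrable setT (EFin \o xi).
Proof.
apply: Rintegrable_le (Rintegrable_add (Rintegrable_cst P 1) gaussian_square_integrable) => //.
move=> w; rewrite -[xi w ^+ 2]real_normK ?num_real//.
have := sqr_ge0 (`|xi w| - 1); have := normr_ge0 (xi w); rewrite sqrrB; nra.
Qed.

Let Rintegral_affine (a : R) (X : T -> R) : P.-integrable setT (EFin \o X) ->
  P.-integrable setT (EFin \o (fun w => 1 + a * X w)) /\
  \int[P]_w (1 + a * X w) = 1 + a * \int[P]_w X w.
Proof.
move=> iX; have iaX := Rintegrable_scale a iX.
have i1 := Rintegrable_cst P 1.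
split; first exact: Rintegrable_add.
by rewrite RintegralD// RintegralZl// Rintegral_prob_cst.
Qed.

(** [1 + a m] is at most the exponential moment [1 + O(a ^ 2)] for small [a] of
    either sign, which forces [m = 0]. *)
Lemma gaussian_mean : \int[P]_w xi w = 0.
Proof.
set m := \int[P]_w xi w.
have key a : 1 + a * m <= expR (a ^+ 2 * s ^+ 2 / 2).
  have [ie <-] := gaussian_exp_moment a.
  have [ia <-] := Rintegral_affine a gaussian_integrable.
  by apply: le_Rintegral => // w _; exact: expR_ge1Dx.
have small a : a ^+ 2 * s ^+ 2 <= 1 -> a * m <= a ^+ 2 * s ^+ 2.
  move=> a1; have := key a; set y := _ / 2 => ay.
  have y0 : 0 <= y by rewrite /y divr_ge0// mulr_ge0 ?sqr_ge0.
  have ey : expR y <= 1 + 2 * y.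
    have eN := expR_ge1Dx (- y); have e0 := expR_gt0 y.
    have eE := expRxMexpNx_1 y.
    have : expR y * (1 - y) <= 1 by rewrite -[X in _ <= X]eE ler_pM2l.
    rewrite /y in a1 *; nra.
  rewrite /y in ay ey; lra.
apply/eqP; case: (eqVneq m 0) => // m0.
have ms : 0 < `|m| * s by rewrite mulr_gt0 ?normr_gt0.
have ss : 0 < s ^+ 2 by rewrite exprn_gt0.
pose k := (2 * s ^+ 2 + `|m| * s)^-1.
have k0 : 0 < k by rewrite invr_gt0; lra.
have kE : k * (2 * s ^+ 2 + `|m| * s) = 1 by rewrite mulVf// gt_eqF//; lra.
have km : k * `|m| * s <= 1 by nra.
have ks : k * s ^+ 2 < 1 by nra.
have := small (k * m).
have -> : (k * m) ^+ 2 * s ^+ 2 = (k * `|m| * s) ^+ 2.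
  by rewrite !exprMn real_normK ?num_real.
have k1 : (k * `|m| * s) ^+ 2 <= 1.
  by rewrite expr_le1// !mulr_ge0// ltW.
move=> /(_ k1).
rewrite !exprMn real_normK ?num_real//.
have q0 : 0 < k * m ^+ 2 by rewrite mulr_gt0// exprn_even_gt0.
have : k * m ^+ 2 * (k * s ^+ 2) < k * m ^+ 2 by rewrite gtr_pMr.
move=> H1 H2; suff : False by []; lra.
Qed.

(** The same device as for the mean, with the expectation [r] of
    [exp (c xi ^ 2)] as a function of [c], of derivative [s ^ 2] at [c = 0]. *)
Lemma gaussian_variance : \int[P]_w (xi w ^+ 2) = s ^+ 2.
Proof.
set v := \int[P]_w (xi w ^+ 2).
have ss : 0 < s ^+ 2 by rewrite exprn_gt0.
have key r : 0 < r -> (r ^+ 2 - 1) * v <= 2 * r ^+ 2 * (r - 1) * s ^+ 2.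
  move=> r0; pose c := (1 - r ^- 2) / (2 * s ^+ 2).
  have rn0 : r != 0 by rewrite gt_eqF.
  have [|ie E] := @gaussian_square_exp_moment (r * s) c (mulr_gt0 r0 s_gt0).
    by rewrite /c; field; rewrite s_neq0 rn0.
  have [ia Ea] := Rintegral_affine c gaussian_square_integrable.
  have : 1 + c * v <= r.
    rewrite -[X in _ <= X](mulfK s_neq0) -E -Ea.
    by apply: le_Rintegral => // w _; exact: expR_ge1Dx.
  have -> : (r ^+ 2 - 1) * v = 2 * r ^+ 2 * s ^+ 2 * (c * v).
    by rewrite /c; field; rewrite s_neq0 rn0.
  have -> : 2 * r ^+ 2 * (r - 1) * s ^+ 2 = 2 * r ^+ 2 * s ^+ 2 * (r - 1) by ring.
  by rewrite ler_pM2l ?mulr_gt0 ?exprn_gt0//; lra.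
have v0 : 0 <= v by apply: Rintegral_ge0 => w _; exact: sqr_ge0.
pose p := v / s ^+ 2 - 1.
have vE : v = (1 + p) * s ^+ 2 by rewrite /p addrC subrK divfK// gt_eqF.
have p1 : 0 <= 1 + p by rewrite /p addrC subrK divr_ge0// ltW.
have {}key r : 0 < r -> (r ^+ 2 - 1) * (1 + p) <= 2 * r ^+ 2 * (r - 1).
  by move=> /key; rewrite vE mulrA ler_pM2r.
rewrite vE (_ : p = 0) ?addr0 ?mul1r//.
(* [r] is taken at a distance of [1] small compared with [p] *)
apply/eqP; rewrite eq_le; apply/andP; split; rewrite leNgt; apply/negP => p0.
  pose e := p / (4 * (1 + p)).
  have eE : e * (4 * (1 + p)) = p by rewrite /e divfK// gt_eqF//; lra.
  have e0 : 0 < e by rewrite /e divr_gt0//; lra.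
  have e1 : e < 1 / 4 by nra.
  have ep : e <= p / 4 by nra.
  have r0 : 0 < 1 + e by lra.
  have := key _ r0.
  rewrite (_ : _ * _ = e * ((2 + e) * (1 + p))); last by ring.
  rewrite (_ : 2 * _ * _ = e * (2 * (1 + e) ^+ 2)); last by ring.
  by rewrite ler_pM2l//; nra.
pose e := - p / 4.
have e0 : 0 < e by rewrite /e; lra.
have r0 : 0 < 1 - e by rewrite /e; lra.
have := key _ r0.
rewrite (_ : _ * _ = - (e * ((2 - e) * (1 + p)))); last by ring.
rewrite (_ : 2 * _ * _ = - (e * (2 * (1 - e) ^+ 2))); last by ring.
rewrite lerN2 ler_pM2l//.
have -> : p = - 4 * e by rewrite /e; field.
have : e <= 1 / 4 by rewrite /e; lra.
nra.
Qed.

End gaussian_variable.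

(** * Second order expansion, one coordinate at a time *)

Section uniform_modulus.
Context {R : realType}.

Lemma compact_uniform_continuity (X : pseudoMetricType R) (f : X -> R)
    (K : set X) (e : R) : continuous f -> compact K -> 0 < e ->
  exists2 dl : R, 0 < dl &
    forall z y, K z -> ball z dl y -> `|f y - f z| < e.
Proof.
move=> cf /compact_near_coveringP cK e0.
have e2 : 0 < e / 2 by rewrite divr_gt0.
pose B (dl : R) (z : X) := forall y, ball z dl y -> `|f y - f z| < e.
have : \forall dl \near (0:R)^'+, K `<=` B dl.
  apply: cK => z Kz.
  have /nbhs_ballP[r /= r0 rf] : \forall y \near z, `|f z - f y| < e / 2.
    by have /cvgrPdist_lt := cf z; apply.
  have r2 : 0 < r / 2 by rewrite divr_gt0.
  exists (ball z (r / 2), [set dl : R | dl < r / 2]) => /=.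
    by split; [exact: nbhsx_ballx|exact: nbhs_right_lt].
  move=> [z' dl] /= [zz' dlr] y yz'.
  have h1 := rf _ (le_ball _ zz').
  have h2 : `|f z - f y| < e / 2.
    apply: rf; rewrite [r](splitr r); apply: ball_triangle zz' _.
    by apply: le_ball yz'; exact: ltW.
  have -> : f y - f z' = (f z - f z') - (f z - f y) by ring.
  have rr : r / 2 <= r by lra.
  by apply: le_lt_trans (ler_normB _ _) _; rewrite (splitr e) ltrD// (h1 rr).
move=> [r /= r0 rK].
exists (r / 2); first by rewrite divr_gt0.
move=> z y Kz; apply: (rK (r / 2)) => //=; last by rewrite divr_gt0.
by rewrite sub0r normrN gtr0_norm ?divr_gt0// ltr_pdivrMr// ltr_pMr// ltr1n.
Qed.

Lemma compact_image_bounded (X : topologicalType) (f : X -> R) (K : set X) :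
    continuous f -> compact K ->
  exists2 M, 0 <= M & forall z, K z -> `|f z| <= M.
Proof.
move=> cf cK.
have : compact (f @` K) by apply: continuous_compact => //; exact: continuous_subspaceT.
move=> /compact_bounded [M [_ /(_ (`|M| + 1))]].
rewrite (le_lt_trans (ler_norm M)) ?ltrDl// => /(_ isT) fM.
exists (`|M| + 1) => [|z Kz]; first by rewrite addr_ge0.
by apply: fM; exists z.
Qed.

Lemma compact_support_bounded (X : topologicalType) (f : X -> R) (K : set X) :
    continuous f -> compact K -> (forall z, ~ K z -> f z = 0) ->
  exists2 M, 0 <= M & forall z, `|f z| <= M.
Proof.
move=> cf cK f0; have [M M0 fM] := compact_image_bounded cf cK.
exists M => // z; have [/fM//|/f0 ->] := pselect (K z).
by rewrite normr0.
Qed.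

(** Uniform continuity with a quadratic error term, which Gaussian increments
    integrate without any cut-off. *)
Lemma quadratic_modulus (V : normedModType R) (f : V -> R) (K : set V) (e : R) :
    continuous f -> compact K -> (forall z, ~ K z -> f z = 0) -> 0 < e ->
  exists2 C, 0 <= C & forall a b, `|f a - f b| <= e + C * `|a - b| ^+ 2.
Proof.
move=> cf cK f0 e0.
have [M M0 fM] := compact_support_bounded cf cK f0.
have [dl dl0 fdl] := compact_uniform_continuity cf cK e0.
have C0 : 0 <= 2 * M / dl ^+ 2.
  by rewrite divr_ge0 ?sqr_ge0// mulr_ge0.
exists (2 * M / dl ^+ 2) => // a b.
have [ab|ab] := ltP `|a - b| dl; last first.
  have : `|f a - f b| <= 2 * M.
    by rewrite (le_trans (ler_normB _ _))// mulr2n mulrDl mul1r lerD.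
  have : 2 * M <= 2 * M / dl ^+ 2 * `|a - b| ^+ 2.
    rewrite -mulrA ler_peMr ?mulr_ge0// mulrC ler_pdivlMr ?exprn_gt0// mul1r.
    by rewrite ler_sqr// nnegrE// ltW.
  lra.
suff ab_e : `|f a - f b| <= e.
  by rewrite (le_trans ab_e)// lerDl mulr_ge0// sqr_ge0.
have [Kb|Kb] := pselect (K b).
  by apply/ltW/fdl => //; rewrite -ball_normE /= distrC.
have [Ka|Ka] := pselect (K a).
  by rewrite distrC; apply/ltW/fdl => //; rewrite -ball_normE.
by rewrite !f0// subrr normr0 ltW.
Qed.

End uniform_modulus.

Section coordinate_taylor.
Context {R : realType}.

Lemma derivable_mean_value (f f1 : R -> R) (y : R) :
    (forall u : R, is_derive u 1 f (f1 u)) ->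
  exists2 c, `|c| <= `|y| & f y - f 0 = f1 c * y.
Proof.
move=> df.
have cf : continuous f by move=> u; apply/differentiable_continuous/derivable1_diffP.
have [y0|y0] := leP 0 y.
  have [c] := @MVT_segment _ f f1 0 y y0 (fun u _ => df u) (continuous_subspaceT cf).
  rewrite in_itv /= subr0 => /andP[c0 cy] ->; exists c => //.
  by rewrite !ger0_norm.
have [c] := @MVT_segment _ f f1 y 0 (ltW y0) (fun u _ => df u) (continuous_subspaceT cf).
rewrite in_itv /= sub0r => /andP[yc c0] E; exists c.
  by rewrite !ler0_norm ?lerN2// ltW.
by rewrite -opprB E mulrN opprK.
Qed.

Lemma second_order_taylor (f f1 f2 : R -> R) (y B : R) :
    (forall u : R, is_derive u 1 f (f1 u)) -> (forall u : R, is_derive u 1 f1 (f2 u)) ->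
    (forall u, `|u| <= `|y| -> `|f2 u - f2 0| <= B) ->
  `|f y - (f 0 + y * f1 0 + y ^+ 2 / 2 * f2 0)| <= B * y ^+ 2.
Proof.
move=> df df1 fB.
pose h1 u := f1 u - f1 0 - u * f2 0.
pose h u := f u - f 0 - u * f1 0 - u ^+ 2 / 2 * f2 0.
have dh1 (u : R) : is_derive u 1 h1 (f2 u - f2 0).
  by apply: is_derive_eq; rewrite /GRing.scale /=; ring.
have dh (u : R) : is_derive u 1 h (h1 u).
  by apply: is_derive_eq; rewrite /h1 /GRing.scale /=; field.
have [c cy hc] := derivable_mean_value y dh.
have [c' cc' hc'] := derivable_mean_value c dh1.
have -> : f y - (f 0 + y * f1 0 + y ^+ 2 / 2 * f2 0) = h y - h 0.
  by rewrite /h; ring.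
have h10 : h1 0 = 0 by rewrite /h1; ring.
move: hc'; rewrite h10 subr0 => hc'.
rewrite hc hc' -mulrA normrM.
have B0 : 0 <= B by apply: le_trans (fB 0 _); rewrite ?normr0 ?subrr ?normr0.
apply: ler_pM => //; first by apply: fB; exact: le_trans cc' cy.
by rewrite normrM -[y ^+ 2]real_normK ?num_real// expr2 ler_wpM2r.
Qed.

End coordinate_taylor.

Section coordinate_steps.
Context {R : realType} {d : nat}.
Implicit Types (z w : 'rV[R]_d) (xi : 'I_d -> R) (j : 'I_d).

Lemma is_derive_coordinate_line (g : 'rV[R]_d -> R) z j (u l : R) :
    is_derive (z + u *: evec R j) (evec R j) g l ->
  is_derive u 1 (fun s : R => g (z + s *: evec R j)) l.
Proof.
have E : (fun h : R => h^-1 *: (((fun s : R => g (z + s *: evec R j)) \o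
      shift u) (h *: 1) - g (z + u *: evec R j))) =
    (fun h : R => h^-1 *: ((g \o shift (z + u *: evec R j)) (h *: evec R j) -
      g (z + u *: evec R j))).
  apply/funext => h /=; congr (_ *: (g _ - _)).
  have -> : h *: (1 : R) = h by rewrite /GRing.scale /= mulr1.
  by rewrite scalerDl addrCA.
move=> [dg gl]; split; first by move: dg; rewrite /derivable E.
by rewrite -gl /derive E.
Qed.

Lemma evec_norm j (y : R) : `|y *: evec R j| <= `|y|.
Proof.
rewrite normrZ ler_piMr// [X in X <= _]mx_normrE.
apply/bigmax_leP; split=> // -[i k] _ /=.
by rewrite mxE; case: (_ && _); rewrite ?normr1 ?normr0.
Qed.

Lemma taylor_coordinate (g g1 g2 : 'rV[R]_d -> R) z j (y e C : R) :
    (forall z, is_derive z (evec R j) g (g1 z)) ->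
    (forall z, is_derive z (evec R j) g1 (g2 z)) ->
    0 <= C -> (forall a b, `|g2 a - g2 b| <= e + C * `|a - b| ^+ 2) ->
  `|g (z + y *: evec R j) - (g z + y * g1 z + y ^+ 2 / 2 * g2 z)| <=
  (e + C * y ^+ 2) * y ^+ 2.
Proof.
move=> dg dg1 C0 gC.
pose line (f : 'rV[R]_d -> R) (s : R) := f (z + s *: evec R j).
have E0 f : line f 0 = f z by rewrite /line scale0r addr0.
have := @second_order_taylor R (line g) (line g1) (line g2) y (e + C * y ^+ 2).
rewrite !E0; apply.
- by move=> u; exact: is_derive_coordinate_line.
- by move=> u; exact: is_derive_coordinate_line.
move=> u uy; apply: le_trans (gC _ _) _; rewrite lerD2l ler_wpM2l//.
rewrite addrAC subrr add0r -[leRHS]real_normK ?num_real//.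
by rewrite ler_sqr ?nnegrE//; apply: le_trans uy; exact: evec_norm.
Qed.

Definition partial_step w xi (k : nat) : 'rV[R]_d :=
  w + \row_j (if (j < k)%N then xi j else 0).

Lemma partial_step0 w xi : partial_step w xi 0 = w.
Proof. by apply/rowP => j; rewrite !mxE addr0. Qed.

Lemma partial_step_full w xi : partial_step w xi d = w + \row_j xi j.
Proof. by apply/rowP => j; rewrite !mxE ltn_ord. Qed.

Lemma partial_stepS w xi j :
  partial_step w xi j.+1 = partial_step w xi j + xi j *: evec R j.
Proof.
apply/rowP => i; rewrite !mxE eqxx /= -addrA; congr (_ + _).
rewrite ltnS leq_eqVlt -val_eqE /=.
case: eqVneq => [/val_inj ->|_] /=; first by rewrite ltnn mulr1 add0r.
by rewrite mulr0 addr0.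
Qed.

Lemma partial_step_dist w xi k :
  `|w - partial_step w xi k| ^+ 2 <= \sum_j xi j ^+ 2.
Proof.
have S0 : 0 <= \sum_j xi j ^+ 2 by apply: sumr_ge0 => j _; exact: sqr_ge0.
rewrite -[leRHS]sqr_sqrtr// ler_sqr ?nnegrE ?sqrtr_ge0//.
rewrite [X in X <= _]mx_normrE; apply/bigmax_leP; split; first exact: sqrtr_ge0.
move=> [i j] _ /=; rewrite ord1 !mxE opprD addNKr normrN.
rewrite -sqrtr_sqr ler_wsqrtr//.
rewrite (bigD1 j)//= -[leLHS]addr0 lerD//; last first.
  by apply: sumr_ge0 => l _; exact: sqr_ge0.
by case: ifP; rewrite ?expr0n ?sqr_ge0.
Qed.

(** A second order expansion of a whole increment, in a form that only involves
    pure second derivatives: each coordinate moves in turn, so the [j]-th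
    coefficients are evaluated at a point that does not depend on [xi j]. *)
Lemma increment_lower_bound (g : 'rV[R]_d -> R) (g1 g2 : 'I_d -> 'rV[R]_d -> R)
    w xi (e C : R) :
    (forall j z, is_derive z (evec R j) g (g1 j z)) ->
    (forall j z, is_derive z (evec R j) (g1 j) (g2 j z)) ->
    0 <= C ->
    (forall j a b, `|g2 j a - g2 j b| <= e + C * `|a - b| ^+ 2) ->
  g w + \sum_j (g1 j (partial_step w xi j) * xi j +
                g2 j (partial_step w xi j) * (xi j ^+ 2 / 2) -
                (e * xi j ^+ 2 + C * xi j ^+ 4)) <= g (w + \row_j xi j).
Proof.
move=> dg dg1 C0 gC.
rewrite -lerBrDl -partial_step_full -[X in _ - g X](partial_step0 w xi).
rewrite -(@telescope_sumr _ 0 d (fun k => g (partial_step w xi k)))// big_mkord.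
apply: ler_sum => j _; rewrite partial_stepS.
have := taylor_coordinate (partial_step w xi j) (xi j) (dg j) (dg1 j) C0 (gC j).
rewrite ler_norml => /andP[+ _].
rewrite (_ : (4 = 2 * 2)%N)// exprM; lra.
Qed.

End coordinate_steps.

(** * One Gaussian step *)

Section one_step.
Context {disp : measure_display} {T : measurableType disp} {R : realType}.
Variable P : probability T R.

Lemma Rintegrable_bounded (f : T -> R) (M : R) : measurable_fun setT f ->
  (forall w, `|f w| <= M) -> P.-integrable setT (EFin \o f).
Proof. by move=> mf fM; apply: (Rintegrable_le mf fM); exact: Rintegrable_cst. Qed.

Context {d : nat}.
Variables (g : 'rV[R]_d -> R) (g1 g2 : 'I_d -> 'rV[R]_d -> R).
Hypothesis dg : forall j z, is_derive z (evec R j) g (g1 j z).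
Hypothesis dg1 : forall j z, is_derive z (evec R j) (g1 j) (g2 j z).
Hypothesis cg : continuous g.
Hypothesis cg1 : forall j, continuous (g1 j).
Hypothesis cg2 : forall j, continuous (g2 j).
Variables (G e C : R) (C_ge0 : 0 <= C).
Hypothesis gG : forall z, `|g z| <= G.
Hypothesis g1G : forall j z, `|g1 j z| <= G.
Hypothesis g2G : forall j z, `|g2 j z| <= G.
Hypothesis g2C : forall j a b, `|g2 j a - g2 j b| <= e + C * `|a - b| ^+ 2.

Variables (I : finType) (X : I -> T -> R) (c : 'I_d -> I).
Hypothesis mX : forall i, measurable_fun setT (X i).
Hypothesis indX : mutually_independent P X.
Hypothesis c_inj : injective c.
Variables (h : R) (h_gt0 : 0 < h).
Hypothesis X_gaussian : forall j (B : set R), measurable B ->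
  P [set w | B (X (c j) w)] = normal_prob 0 (Num.sqrt h) B.

Variables (Psi : T -> R) (M : R) (Z : T -> 'rV[R]_d).
Hypothesis Psi_ge0 : forall w, 0 <= Psi w.
Hypothesis Psi_le : forall w, Psi w <= M.
Hypothesis mPsi : measurable_fun setT Psi.
Hypothesis mZ : forall i, measurable_fun setT (fun w => Z w 0 i).
Hypothesis mPsi_past : forall j,
  measurable_fun [set: g_sigma_algebraType (generated_without X (c j))] Psi.
Hypothesis mZ_past : forall j i,
  measurable_fun [set: g_sigma_algebraType (generated_without X (c j))]
    (fun w => Z w 0 i).

Let xi w j := X (c j) w.
Let Y j w := partial_step (Z w) (xi w) j.

Let sh_gt0 : 0 < Num.sqrt h. Proof. by rewrite sqrtr_gt0. Qed.

Let mY j i : measurable_fun setT (fun w => Y j w 0 i).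
Proof.
have -> : (fun w => Y j w 0 i) =
    (fun w => Z w 0 i + if (i < j)%N then xi w i else 0); last first.
  by apply: measurable_funD => //; case: (i < j)%N => //; exact: mX.
by apply/funext => w; rewrite /Y /partial_step !mxE.
Qed.

Let mY_past (j : 'I_d) i :
  measurable_fun [set: g_sigma_algebraType (generated_without X (c j))]
    (fun w => Y j w 0 i).
Proof.
have -> : (fun w => Y j w 0 i) =
    (fun w => Z w 0 i + if (i < j)%N then xi w i else 0); last first.
  apply: measurable_funD; first exact: mZ_past.
  case: (boolP (i < j)%N) => // ij; apply: measurable_generated_without.
  by rewrite (inj_eq c_inj) -val_eqE /= ltn_eqF.
by apply/funext => w; rewrite /Y /partial_step !mxE.
Qed.

Let M_ge0 (w0 : T) : 0 <= M. Proof. exact: le_trans (Psi_ge0 w0) (Psi_le w0). Qed.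

Let bounded_factor (f : 'rV[R]_d -> R) (U : T -> 'rV[R]_d) :
  (forall z, `|f z| <= G) -> forall w, `|Psi w * f (U w)| <= M * G.
Proof. by move=> fG w; rewrite normrM ler_pM// ger0_norm. Qed.

Let moment (f : 'rV[R]_d -> R) (j : 'I_d) (p : R -> R) :
    continuous f -> (forall z, `|f z| <= G) -> measurable_fun setT p ->
    P.-integrable setT (EFin \o (p \o X (c j))) ->
  P.-integrable setT (EFin \o (fun w => Psi w * f (Y j w) * p (xi w j))) /\
  \int[P]_w (Psi w * f (Y j w) * p (xi w j)) =
  \int[P]_w (Psi w * f (Y j w)) * \int[P]_w p (xi w j).
Proof.
move=> cf fG mp ip.
have mf : measurable_fun setT (fun w => Psi w * f (Y j w)).
  by apply: measurable_funM => //; apply: measurable_comp_continuous.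
apply: (@expectation_mul_generated _ _ _ P I X (c j) (fun w => Psi w * f (Y j w)) p) => //.
- apply: measurable_funM => //.
  by apply: (@measurable_comp_continuous _ _ _
    (g_sigma_algebraType (generated_without X (c j))) (Y j) f).
- by apply: (Rintegrable_bounded mf); exact: bounded_factor.
Qed.

Let ssE : Num.sqrt h ^+ 2 = h. Proof. by rewrite sqr_sqrtr// ltW. Qed.

Let square_moment (j : 'I_d) :
  P.-integrable setT (EFin \o (fun w => xi w j ^+ 2)) /\
  \int[P]_w (xi w j ^+ 2) = h.
Proof.
split; first exact: (gaussian_square_integrable sh_gt0 (mX (c j)) (@X_gaussian j)).
by rewrite (gaussian_variance sh_gt0 (mX (c j)) (@X_gaussian j)).
Qed.

Let fourth_moment (j : 'I_d) :
  P.-integrable setT (EFin \o (fun w => xi w j ^+ 4)) /\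
  \int[P]_w (xi w j ^+ 4) <= 30 * h ^+ 2.
Proof.
rewrite -ssE -exprM.
exact: (gaussian_fourth_moment sh_gt0 (mX (c j)) (@X_gaussian j)).
Qed.

Let integrable_Psi (f : 'rV[R]_d -> R) (U : T -> 'rV[R]_d) :
    continuous f -> (forall z, `|f z| <= G) ->
    (forall i, measurable_fun setT (fun w => U w 0 i)) ->
  P.-integrable setT (EFin \o (fun w => Psi w * f (U w))).
Proof.
move=> cf fG mU; apply: (@Rintegrable_bounded _ (M * G)); last exact: bounded_factor.
by apply: measurable_funM => //; exact: measurable_comp_continuous.
Qed.

Let e_ge0 (j : 'I_d) : 0 <= e.
Proof. by have := g2C j 0 0; rewrite !subrr !normr0 expr0n /= mulr0 addr0. Qed.

(** Moving the evaluation point from [Y j] back to [Z] costs [e] plus [C] times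
    the expected squared length of the increment, [d h]. *)
Let second_order_term (j : 'I_d) :
  \int[P]_w (Psi w * g2 j (Z w)) - M * (e + C * (d%:R * h)) <=
  \int[P]_w (Psi w * g2 j (Y j w)).
Proof.
pose S w := \sum_i xi w i ^+ 2.
have iS : P.-integrable setT (EFin \o S).
  by apply: Rintegrable_sum => i; have [] := square_moment i.
have ES : \int[P]_w S w = d%:R * h.
  rewrite Rintegral_sum => [|i]; last by have [] := square_moment i.
  under eq_bigr => i _ do rewrite (square_moment i).2.
  by rewrite sumr_const card_ord mulr_natl.
pose E w := e + C * S w.
have iE : P.-integrable setT (EFin \o E).
  by apply: Rintegrable_add; [exact: Rintegrable_cst|exact: Rintegrable_scale].
have iME := Rintegrable_scale M iE.
have EE : \int[P]_w (M * E w) = M * (e + C * (d%:R * h)).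
  rewrite RintegralZl// RintegralD//; last 2 first.
    exact: Rintegrable_cst.
    exact: Rintegrable_scale.
  by rewrite Rintegral_prob_cst RintegralZl// ES.
have iY : P.-integrable setT (EFin \o (fun w => Psi w * g2 j (Y j w))).
  exact: integrable_Psi.
rewrite lerBlDr -EE -RintegralD//.
apply: le_Rintegral => //.
- exact: integrable_Psi.
- exact: Rintegrable_add.
move=> w _.
have : g2 j (Z w) <= g2 j (Y j w) + E w.
  have := g2C j (Z w) (Y j w); rewrite ler_norml => /andP[_].
  rewrite lerBlDl => /le_trans; apply; rewrite lerD2l lerD2l ler_wpM2l//.
  exact: partial_step_dist.
have E0 : 0 <= E w.
  rewrite addr_ge0 ?(e_ge0 j) ?mulr_ge0// sumr_ge0// => l _.
  exact: sqr_ge0.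
move=> /(ler_wpM2l (Psi_ge0 w)) /le_trans; apply.
by rewrite mulrDr lerD2l ler_wpM2r.
Qed.

(** [Psi] and [Z] belong to the past and [Y j] only uses the coordinates before
    [j], so [xi j] is independent of its coefficients in [increment_lower_bound]:
    the first order terms have expectation [0], and the second order ones give
    [(h / 2) g2 j]. The remainder is controlled by the second and fourth
    moments. *)
Lemma one_step_lower_bound :
  \int[P]_w (Psi w * g (Z w)) + h / 2 * \sum_j \int[P]_w (Psi w * g2 j (Z w))
    - d%:R * M * h * (2 * e + C * (d%:R + 30) * h)
  <= \int[P]_w (Psi w * g (Z w + \row_j X (c j) w)).
Proof.
have M0 := M_ge0 point.
pose A j w := Psi w * g1 j (Y j w) * xi w j.
pose B j w := Psi w * g2 j (Y j w) * (xi w j ^+ 2 / 2).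
pose Err j w := M * (e * xi w j ^+ 2 + C * xi w j ^+ 4).
have [iA EA] : (forall j, P.-integrable setT (EFin \o A j)) /\
    forall j, \int[P]_w A j w = 0.
  have H j := moment (p := id) (cg1 (j:=j)) (g1G j) (@measurable_id _ _ _)
    (gaussian_integrable sh_gt0 (mX (c j)) (@X_gaussian j)).
  split=> j; first by have [] := H j.
  rewrite (H j).2 (gaussian_mean sh_gt0 (mX (c j)) (@X_gaussian j)) mulr0 //.
have [iB EB] : (forall j, P.-integrable setT (EFin \o B j)) /\
    forall j, \int[P]_w B j w = \int[P]_w (Psi w * g2 j (Y j w)) * (h / 2).
  have i2 j : P.-integrable setT (EFin \o (fun w => xi w j ^+ 2 / 2)).
    apply: eq_integrable (Rintegrable_scale 2^-1 (square_moment j).1) => // w _ /=.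
    by rewrite mulrC.
  have mp : measurable_fun [set: R] (fun r : R => r ^+ 2 / 2).
    by apply: measurable_funM => //; exact: measurable_funX.
  have H j := moment (p := fun r => r ^+ 2 / 2) (cg2 (j:=j)) (g2G j) mp (i2 j).
  split=> j; first by have [] := H j.
  rewrite (H j).2; congr (_ * _).
  by rewrite RintegralZr ?(square_moment j).2//; have [] := square_moment j.
have iErr j : P.-integrable setT (EFin \o Err j).
  apply: Rintegrable_scale; apply: Rintegrable_add; apply: Rintegrable_scale.
    by have [] := square_moment j.
  by have [] := fourth_moment j.
have EErr j : \int[P]_w Err j w <= M * (e * h + C * (30 * h ^+ 2)).
  have i2 := Rintegrable_scale e (square_moment j).1.
  have i4 := Rintegrable_scale C (fourth_moment j).1.
  rewrite RintegralZl//; last exact: Rintegrable_add.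
  rewrite ler_wpM2l// RintegralD// !RintegralZl//.
  - by rewrite (square_moment j).2 lerD2l ler_wpM2l// (fourth_moment j).2.
  - exact: (fourth_moment j).1.
  - exact: (square_moment j).1.
pose L w := Psi w * g (Z w) + \sum_j (A j w + B j w + - 1 * Err j w).
have iAB j : P.-integrable setT (EFin \o (fun w => A j w + B j w)).
  exact: Rintegrable_add.
have iN j := Rintegrable_scale (- 1) (iErr j).
have iABE j : P.-integrable setT (EFin \o (fun w => A j w + B j w + - 1 * Err j w)).
  exact: Rintegrable_add.
have ig : P.-integrable setT (EFin \o (fun w => Psi w * g (Z w))).
  exact: integrable_Psi.
have iL : P.-integrable setT (EFin \o L).
  by apply: Rintegrable_add => //; exact: Rintegrable_sum.
have EL : \int[P]_w L w = \int[P]_w (Psi w * g (Z w)) +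
    \sum_j (\int[P]_w (Psi w * g2 j (Y j w)) * (h / 2) - \int[P]_w Err j w).
  rewrite RintegralD//; last exact: Rintegrable_sum.
  congr (_ + _); rewrite Rintegral_sum//; apply: eq_bigr => j _.
  by rewrite !RintegralD// EA EB add0r RintegralZl// mulN1r.
apply: (@le_trans _ _ (\int[P]_w L w)).
  rewrite EL -addrA lerD2l mulr_sumr.
  rewrite (_ : d%:R * M * h * _ = \sum_(j < d) M * h * (2 * e + C * (d%:R + 30) * h)).
    rewrite -sumrB; apply: ler_sum => j _.
    have e0 := e_ge0 j.
    have := EErr j; have := second_order_term j.
    set a := \int[P]_w _; set b := \int[P]_w _; set r := \int[P]_w _ => ab re.
    have h2 : 0 < h / 2 by rewrite divr_gt0.
    have : (a - M * (e + C * (d%:R * h))) * (h / 2) <= b * (h / 2) by rewrite ler_pM2r.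
    have : 0 <= M * e * h by rewrite !mulr_ge0// ltW.
    have : 0 <= M * C * d%:R * h * h by rewrite !mulr_ge0// ltW.
    nra.
  by rewrite sumr_const card_ord -[in RHS]mulr_natl; ring.
apply: le_Rintegral => //.
  apply: (integrable_Psi cg gG) => i.
  under eq_fun do rewrite !mxE.
  by apply: measurable_funD => //; exact: mX.
move=> w _.
have := increment_lower_bound (Z w) (xi w) dg dg1 C_ge0 g2C.
move=> /(ler_wpM2l (Psi_ge0 w)); apply: le_trans.
rewrite mulrDr lerD2l mulr_sumr; apply: ler_sum => j _.
have e0 := e_ge0 j.
have Er0 : 0 <= e * xi w j ^+ 2 + C * xi w j ^+ 4.
  by rewrite addr_ge0// mulr_ge0 ?sqr_ge0// (_ : (4 = 2 * 2)%N)// exprM sqr_ge0.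
have := ler_wpM2r Er0 (Psi_le w); rewrite /A /B /Err /Y; lra.
Qed.

End one_step.

(** * The weighted walk on a time grid *)

Section discrete_weight.
Context {R : realType} {d : nat}.
Variables (K : set 'rV[R]_d) (V : 'rV[R]_d -> R) (lambda : R).

(** The Feynman-Kac weight with the time integral replaced by a Riemann sum and
    with killing at the grid times outside [K]. *)
Definition discrete_weight (h : R) (u : nat -> 'rV[R]_d) (k : nat) : R :=
  (\prod_(i < k) \1_K (u i)) * expR (h * \sum_(i < k) (lambda - V (u i))).

Lemma discrete_weight0 h u : discrete_weight h u 0 = 1.
Proof. by rewrite /discrete_weight !big_ord0 mulr0 expR0 mulr1. Qed.

Lemma discrete_weightS h u k : discrete_weight h u k.+1 =
  discrete_weight h u k * (\1_K (u k) * expR (h * (lambda - V (u k)))).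
Proof.
by rewrite /discrete_weight !big_ord_recr /= mulrDr expRD; ring.
Qed.

Lemma discrete_weight_ge0 h u k : 0 <= discrete_weight h u k.
Proof.
rewrite mulr_ge0 ?expR_ge0//; apply: prodr_ge0 => i _.
by rewrite indicE.
Qed.

Lemma discrete_weight_le h u k : (forall z, 0 <= V z) -> 0 <= h ->
  discrete_weight h u k <= expR (k%:R * h * `|lambda|).
Proof.
move=> V0 h0; elim: k => [|k IH]; first by rewrite discrete_weight0 !mul0r expR0.
rewrite discrete_weightS -natr1 !mulrDl mul1r expRD.
apply: ler_pM; rewrite ?discrete_weight_ge0 ?mulr_ge0 ?expR_ge0 ?indicE//.
rewrite -[leRHS]mul1r ler_pM ?expR_ge0//; first by case: (_ \in _).
rewrite ler_expR ler_wpM2l// (le_trans _ (ler_norm lambda))//.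
by rewrite gerBl.
Qed.

Lemma measurable_discrete_weight {disp} {T : measurableType disp}
    (h : R) (U : nat -> T -> 'rV[R]_d) k : closed K -> continuous V ->
    (forall i, (i < k)%N -> forall l, measurable_fun setT (fun w => U i w 0 l)) ->
  measurable_fun setT (fun w => discrete_weight h (U ^~ w) k).
Proof.
move=> cK cV; elim: k => [|k IH] mU.
  under eq_fun do rewrite discrete_weight0; exact: measurable_cst.
under eq_fun do rewrite discrete_weightS.
apply: measurable_funM; first by apply: IH => i ik; apply: mU; exact: leqW.
apply: measurable_funM.
  have -> : (fun w => \1_K (U k w)) = \1_(U k @^-1` K) :> (T -> R).
    by apply/funext => w; rewrite !indicE.
  by apply/measurable_indic/measurable_preimage_closed => // l; exact: mU.
apply: measurableT_comp => //; apply: measurable_funM => //.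
apply: measurable_funB => //.
by apply: (measurable_comp_continuous (f := V)) => // l; exact: mU.
Qed.

End discrete_weight.

Section brownian_grid.
Context {disp : measure_display} {T : measurableType disp} {R : realType}.
Variable P : probability T R.
Context {d : nat}.
Variables (x : 'rV[R]_d) (W : R -> T -> 'rV[R]_d).
Hypothesis BW : brownian_motion P x W.
Variables (h : R) (h_gt0 : 0 < h).

Let grid (i : nat) : R := i%:R * h.

Let grid_ge0 i : 0 <= grid i. Proof. by rewrite mulr_ge0// ltW. Qed.

Let grid_lt i : grid i < grid i.+1.
Proof. by rewrite /grid -natr1 mulrDl mul1r ltrDl. Qed.

Definition grid_increment k (ij : 'I_k * 'I_d) (w : T) : R :=
  W (grid ij.1.+1) w 0 ij.2 - W (grid ij.1) w 0 ij.2.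

Lemma grid_increment_measurable k ij : measurable_fun setT (@grid_increment k ij).
Proof. by apply: measurable_funB; exact: (bm_measurable BW). Qed.

Lemma grid_increment_independent k : mutually_independent P (@grid_increment k).
Proof. by apply: (bm_independent BW) => //. Qed.

Lemma grid_increment_gaussian k ij (B : set R) : measurable B ->
  P [set w | B (@grid_increment k ij w)] = normal_prob 0 (Num.sqrt h) B.
Proof.
move=> mB.
have <- : grid ij.1.+1 - grid ij.1 = h.
  by rewrite /grid -[ij.1.+1%:R]natr1 mulrDl mul1r addrAC subrr add0r.
exact: (bm_gaussian BW).
Qed.

(** The position at a grid time is [x] plus the earlier increments, none of which
    is the one left out. *)
Lemma grid_past_measurable k (j : 'I_d) i (l : 'I_d) : (i <= k)%N ->
  measurable_fun
    [set: g_sigma_algebraType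
            (generated_without (@grid_increment k.+1) (ord_max, j))]
    (fun w => W (grid i) w 0 l).
Proof.
elim: i => [_|i IH ik].
  have -> : (fun w => W (grid 0) w 0 l) = cst (x 0 l).
    by apply/funext => w; rewrite /grid mul0r (bm_start BW).
  exact: measurable_cst.
have -> : (fun w => W (grid i.+1) w 0 l) =
    (fun w => W (grid i) w 0 l + @grid_increment k.+1 (inord i, l) w); last first.
  apply: measurable_funD; first by apply: IH; exact: ltnW.
  apply: measurable_generated_without.
  by rewrite xpair_eqE negb_and -val_eqE /= inordK ?ltn_eqF// ltnS ltnW.
by apply/funext => w; rewrite /grid_increment /= inordK ?subrKC// ltnS ltnW.
Qed.

End brownian_grid.

(** A compactly supported [C^2] subsolution of [(1/2) Laplacian g = (V - lambda) g],
    up to the error [eta]. Only pure second derivatives occur, and they are data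
    so that explicit formulas can be supplied for them. *)
Record compact_subsolution {R : realType} {d : nat} (K : set 'rV[R]_d)
    (V : 'rV[R]_d -> R) (lambda eta : R) (g : 'rV[R]_d -> R)
    (g1 g2 : 'I_d -> 'rV[R]_d -> R) : Prop := {
  sub_derive1 : forall j z, is_derive z (evec R j) g (g1 j z);
  sub_derive2 : forall j z, is_derive z (evec R j) (g1 j) (g2 j z);
  sub_continuous : continuous g;
  sub_continuous1 : forall j, continuous (g1 j);
  sub_continuous2 : forall j, continuous (g2 j);
  sub_ge0 : forall z, 0 <= g z;
  sub_compact : compact K;
  sub_support : forall z, ~ K z -> g z = 0;
  sub_support1 : forall j z, ~ K z -> g1 j z = 0;
  sub_support2 : forall j z, ~ K z -> g2 j z = 0;
  sub_laplacian : forall z, K z ->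
    (V z - lambda) * g z - eta <= 2^-1 * \sum_j g2 j z }.

Section walk_lower_bound.
Context {disp : measure_display} {T : measurableType disp} {R : realType}.
Variable P : probability T R.
Context {d : nat}.
Variables (x : 'rV[R]_d) (W : R -> T -> 'rV[R]_d).
Hypothesis BW : brownian_motion P x W.
Variables (K : set 'rV[R]_d) (V : 'rV[R]_d -> R) (lambda eta : R).
Hypothesis cV : continuous V.
Hypothesis V_ge0 : forall z, 0 <= V z.
Hypothesis eta_ge0 : 0 <= eta.
Variables (g : 'rV[R]_d -> R) (g1 g2 : 'I_d -> 'rV[R]_d -> R).
Hypothesis sub : compact_subsolution K V lambda eta g g1 g2.

Let dg := sub_derive1 sub.
Let dg1 := sub_derive2 sub.
Let cg := sub_continuous sub.
Let cg1 := sub_continuous1 sub.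
Let cg2 := sub_continuous2 sub.
Let g_ge0 := sub_ge0 sub.
Let cK := sub_compact sub.
Let g_off := sub_support sub.
Let g1_off := sub_support1 sub.
Let g2_off := sub_support2 sub.
Let g_sub := sub_laplacian sub.

Let closedK : closed K.
Proof. by apply: compact_closed => //; exact: norm_hausdorff. Qed.

Let weight := discrete_weight K V lambda.

Let grid (h : R) (i : nat) : R := i%:R * h.

Section fixed_mesh.
Variables (h : R) (h_gt0 : 0 < h).
Variables (G L M e C : R) (C_ge0 : 0 <= C).
Hypothesis gG : forall z, `|g z| <= G.
Hypothesis g1G : forall j z, `|g1 j z| <= G.
Hypothesis g2G : forall j z, `|g2 j z| <= G.
Hypothesis g2C : forall j a b, `|g2 j a - g2 j b| <= e + C * `|a - b| ^+ 2.
Hypothesis VL : forall z, K z -> `|V z - lambda| <= L.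
Hypothesis hL : h * L <= 1.

Let wt k w := weight h (fun i => W (grid h i) w) k.
Let loss := M * (h * eta + h ^+ 2 * L ^+ 2 * G) +
  d%:R * M * h * (2 * e + C * (d%:R + 30) * h).

Let mgrid i l : measurable_fun setT (fun w => W (grid h i) w 0 l).
Proof. by apply: (bm_measurable BW); rewrite mulr_ge0// ltW. Qed.

Let mwt k : measurable_fun setT (wt k).
Proof.
apply: (@measurable_discrete_weight _ _ K V lambda _ T h
  (fun i w => W (grid h i) w)) => // i _ l; exact: mgrid.
Qed.

(** With [y = h (V - lambda)], a step multiplies the weight by [exp (- y) >= 1 - y]
    and raises the expectation of [g] by the factor [1 + y] at least, up
    to [h eta], and [(1 - y) (1 + y) = 1 - y ^ 2] differs from [1] by [O(h ^ 2)]
    only. The bound [h L <= 1] makes [1 + y] nonnegative. Outside [K] the path is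
    killed, which loses nothing since [g] vanishes there. *)
Lemma weighted_step k : (forall w, wt k w <= M) -> (forall w, wt k.+1 w <= M) ->
  \int[P]_w (wt k w * g (W (grid h k) w)) - loss <=
  \int[P]_w (wt k.+1 w * g (W (grid h k.+1) w)).
Proof.
move=> wM wSM.
have G0 : 0 <= G by apply: le_trans (normr_ge0 _) (gG 0).
have M0 : 0 <= M by apply: le_trans (wM point); exact: discrete_weight_ge0.
have mwt_past j : measurable_fun [set: g_sigma_algebraType
    (generated_without (@grid_increment _ _ _ _ W h k.+1) (ord_max, j))] (wt k.+1).
  apply: (@measurable_discrete_weight _ _ K V lambda _
    (g_sigma_algebraType (generated_without (@grid_increment _ _ _ _ W h k.+1) (ord_max, j)))
    h (fun i w => W (grid h i) w)) => // i ik l.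
  by apply: (grid_past_measurable BW).
have := @one_step_lower_bound _ T R P d g g1 g2 dg dg1 cg cg1 cg2 G e C C_ge0
  gG g1G g2G g2C _ (@grid_increment _ _ _ _ W h k.+1) (fun j => (ord_max, j))
  (grid_increment_measurable BW h_gt0 (k:=k.+1))
  (grid_increment_independent BW h_gt0 (k:=k.+1)) _ h h_gt0
  (fun j => grid_increment_gaussian BW h_gt0 (ord_max, j)) (wt k.+1) M
  (fun w => W (grid h k) w) _ wSM (mwt (k.+1)) (mgrid k) mwt_past _.
have -> : (fun w => wt k.+1 w * g (W (grid h k) w +
    \row_j @grid_increment _ _ _ _ W h k.+1 (ord_max, j) w)) =
    (fun w => wt k.+1 w * g (W (grid h k.+1) w)).
  apply/funext => w; congr (_ * g _); apply/rowP => j.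
  by rewrite !mxE /grid_increment /= subrKC.
move=> /(_ _ _ _) H; apply: le_trans (H _ _ _); last 3 first.
- by move=> i j [].
- by move=> w; exact: discrete_weight_ge0.
- by move=> j i; apply: (grid_past_measurable BW).
rewrite /loss opprD addrA lerD2r.
set c0 := M * _.
have iw (f : 'rV[R]_d -> R) m : continuous f -> (forall z, `|f z| <= G) ->
    (forall w, wt m w <= M) ->
    P.-integrable setT (EFin \o (fun w => wt m w * f (W (grid h k) w))).
  move=> cf fG wmM; apply: (@Rintegrable_bounded _ _ _ _ _ (M * G)).
    by apply: measurable_funM => //; exact: measurable_comp_continuous.
  by move=> w; rewrite normrM ler_pM// ger0_norm//; exact: discrete_weight_ge0.
have i2 j := Rintegrable_scale (h / 2) (iw (g2 j) k.+1 (@cg2 j) (g2G j) wSM).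
rewrite mulr_sumr -[c0](Rintegral_prob_cst P) -RintegralB//; last 2 first.
  exact: iw.
  exact: Rintegrable_cst.
under eq_bigr => j _ do rewrite -(RintegralZl _ measurableT (iw _ _ (@cg2 j) (g2G j) wSM)).
rewrite -Rintegral_sum// -RintegralD//; last 2 first.
  exact: iw.
  exact: Rintegrable_sum.
apply: le_Rintegral => //.
- apply: (@integrableB _ _ _ P setT measurableT
    (EFin \o (fun w => wt k w * g (W (grid h k) w))) (EFin \o (fun=> c0))).
    exact: iw.
  exact: Rintegrable_cst.
- by apply: Rintegrable_add; [exact: iw|exact: Rintegrable_sum].
move=> w _; set z := W (grid h k) w.
have c00 : 0 <= c0.
  apply: mulr_ge0 => //; apply: addr_ge0; first by rewrite mulr_ge0// ltW.
  by apply: mulr_ge0 => //; apply: mulr_ge0; exact: sqr_ge0.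
rewrite [wt k.+1 w]discrete_weightS -/(wt k w) -/z indicE.
have [Kz|nKz] := pselect (K z); last first.
  rewrite memNset// !mul0r mulr0 mul0r add0r big1 ?g_off// => [|j _].
    by rewrite mulr0 sub0r oppr_le0.
  by rewrite mul0r mulr0.
rewrite mem_set// mul1r -!mulr_sumr.
have -> : h * (lambda - V z) = - (h * (V z - lambda)) by ring.
set y := h * (V z - lambda).
have y1 : `|y| <= 1.
  by rewrite normrM gtr0_norm// (le_trans _ hL)// ler_pM2l// VL.
have yL : y ^+ 2 <= h ^+ 2 * L ^+ 2.
  rewrite exprMn ler_pM2l ?exprn_gt0// -[leLHS]real_normK ?num_real//.
  rewrite ler_sqr ?nnegrE// ?VL//.
  exact: le_trans (VL Kz).
set E := expR (- y); set Q := wt k w.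
have Q0 : 0 <= Q by exact: discrete_weight_ge0.
have QM : Q <= M by exact: wM.
have QEM : Q * E <= M.
  have := wSM w; rewrite [wt k.+1 w]discrete_weightS -/(wt k w) -/z indicE mem_set// mul1r.
  by rewrite (_ : h * (lambda - V z) = - y)// /y; ring.
have E1 : 1 - y <= E by exact: expR_ge1Dx.
have gz0 := g_ge0 z.
have gzG : g z <= G by rewrite (le_trans (ler_norm _)).
have subz : y * g z - h * eta <= h / 2 * \sum_j g2 j z.
  rewrite (_ : y * g z - h * eta = h * ((V z - lambda) * g z - eta)); last by rewrite /y; ring.
  by rewrite -mulrA ler_pM2l// g_sub.
have QE0 : 0 <= Q * E by rewrite mulr_ge0// expR_ge0.
rewrite (_ : h / 2 * (Q * E * \sum_j g2 j z) = Q * E * (h / 2 * \sum_j g2 j z)); last by ring.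
have s1 : Q * E * (y * g z - h * eta) <= Q * E * (h / 2 * \sum_j g2 j z).
  exact: ler_wpM2l.
have s2 : Q * E * (h * eta) <= M * (h * eta) by rewrite ler_wpM2r// mulr_ge0// ltW.
have s3 : Q * (1 - y ^+ 2) * g z <= Q * E * (1 + y) * g z.
  rewrite -!(mulrA Q) ler_wpM2l// ler_wpM2r//.
  have := ler_wpM2r (_ : 0 <= 1 + y) E1.
  rewrite (_ : (1 - y) * (1 + y) = 1 - y ^+ 2); last by ring.
  by apply; move: y1; rewrite ler_norml; lra.
have s4 : Q * y ^+ 2 * g z <= M * (h ^+ 2 * L ^+ 2) * G.
  apply: ler_pM => //; first by rewrite mulr_ge0// sqr_ge0.
  by apply: ler_pM => //; exact: sqr_ge0.
rewrite /c0 -[discrete_weight _ _ _ _ _ _]/Q; lra.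
Qed.

Lemma weighted_walk N : (forall k w, (k <= N)%N -> wt k w <= M) ->
  forall k, (k <= N)%N ->
  g x - k%:R * loss <= \int[P]_w (wt k w * g (W (grid h k) w)).
Proof.
move=> wM; elim=> [_|k IH kN].
  rewrite mul0r subr0.
  under eq_Rintegral => w _ do
    rewrite /wt /weight discrete_weight0 mul1r /grid mul0r (bm_start BW).
  by rewrite Rintegral_prob_cst.
apply: le_trans (weighted_step _ _) => [|w|w]; last 2 first.
  by apply: wM; exact: ltnW.
  exact: wM.
by rewrite -natr1 mulrDl mul1r opprD addrA lerD2r IH// ltnW.
Qed.

End fixed_mesh.

(** The [N] losses add up to [t] times [M eta + 2 d M e1 + O(h)]: the precision [e1]
    of the modulus of continuity of the second derivatives is chosen first, then
    the mesh [h]. *)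
Lemma grid_walk_lower_bound (t e : R) : 0 < t -> 0 < e ->
  exists N0, forall N, (N0 < N)%N ->
    g x - expR (t * `|lambda|) * t * eta - e <=
    \int[P]_w (weight (t / N%:R) (fun i => W (grid (t / N%:R) i) w) N * g (W t w)).
Proof.
move=> t0 e0.
have [G G0 [gG g1G g2G]] : exists2 G, 0 <= G & [/\ forall z, `|g z| <= G,
    forall j z, `|g1 j z| <= G & forall j z, `|g2 j z| <= G].
  have [G' G'0 gG'] := compact_support_bounded cg cK g_off.
  have /choice[F FE] : forall j, exists B, 0 <= B /\ forall z, `|g1 j z| <= B.
    by move=> j; have [B] := compact_support_bounded (@cg1 j) cK (g1_off j); exists B.
  have /choice[F' F'E] : forall j, exists B, 0 <= B /\ forall z, `|g2 j z| <= B.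
    by move=> j; have [B] := compact_support_bounded (@cg2 j) cK (g2_off j); exists B.
  have S0 : 0 <= \sum_j F j by apply: sumr_ge0 => j _; have [] := FE j.
  have S'0 : 0 <= \sum_j F' j by apply: sumr_ge0 => j _; have [] := F'E j.
  have FS j : F j <= \sum_j F j.
    by rewrite (bigD1 j)//= lerDl sumr_ge0// => k _; have [] := FE k.
  have F'S j : F' j <= \sum_j F' j.
    by rewrite (bigD1 j)//= lerDl sumr_ge0// => k _; have [] := F'E k.
  exists (G' + \sum_j F j + \sum_j F' j); first by rewrite !addr_ge0.
  split=> [z|j z|j z].
  - by have := gG' z; lra.
  - by have := (FE j).2 z; have := FS j; lra.
  - by have := (F'E j).2 z; have := F'S j; lra.
have [L L0 VL] : exists2 L, 0 <= L & forall z, K z -> `|V z - lambda| <= L.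
  have [B B0 VB] := compact_image_bounded cV cK.
  exists (B + `|lambda|) => [|z Kz]; first by rewrite addr_ge0.
  by rewrite (le_trans (ler_normB _ _))// lerD2r VB.
pose M := expR (t * `|lambda|).
have M0 : 0 < M by exact: expR_gt0.
pose e1 := e / (4 * (d%:R * t * M + 1)).
have dtM : 0 <= d%:R * t * M by rewrite !mulr_ge0// ltW.
have e10 : 0 < e1 by rewrite divr_gt0// mulr_gt0//; lra.
have e1E : 4 * (d%:R * t * M) * e1 <= e.
  have : e1 * (4 * (d%:R * t * M + 1)) = e by rewrite divfK// gt_eqF//; lra.
  nra.
have [C C0 g2C] : exists2 C, 0 <= C &
    forall j a b, `|g2 j a - g2 j b| <= e1 + C * `|a - b| ^+ 2.
  have /choice[F FE] : forall j, exists C, 0 <= C /\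
      forall a b, `|g2 j a - g2 j b| <= e1 + C * `|a - b| ^+ 2.
    by move=> j; have [C] := quadratic_modulus (@cg2 j) cK (g2_off j) e10; exists C.
  exists (\sum_j F j) => [|j a b].
    by apply: sumr_ge0 => j _; have [] := FE j.
  apply: le_trans ((FE j).2 a b) _; rewrite lerD2l ler_wpM2r ?sqr_ge0//.
  by rewrite (bigD1 j)//= lerDl sumr_ge0// => k _; have [] := FE k.
pose B := M * L ^+ 2 * G + d%:R * M * C * (d%:R + 30).
have B0 : 0 <= B.
  by rewrite addr_ge0// !mulr_ge0 ?sqr_ge0 ?addr_ge0// ltW.
have mesh D : 0 <= D -> exists N0, forall N, (N0 < N)%N -> t / N%:R * D <= 1.
  move=> D0; exists (Num.truncn (t * D)) => N NN.
  have N0 : 0 < N%:R :> R by rewrite ltr0n (leq_ltn_trans _ NN).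
  rewrite mulrAC ler_pdivrMr// mul1r (le_trans (ltW (truncnS_gt _)))//.
  by rewrite ler_nat.
have [N1 N1P] := mesh L L0.
have [|N2 N2P] := mesh (2 * t * B / e).
  by rewrite divr_ge0 ?mulr_ge0// ltW.
exists (maxn N1 N2) => N; rewrite gtn_max => /andP[N1N N2N].
have N0 : 0 < N%:R :> R by rewrite ltr0n (leq_ltn_trans _ N1N).
pose h := t / N%:R.
have h0 : 0 < h by rewrite divr_gt0.
have Nh : N%:R * h = t by rewrite /h mulrC divfK// gt_eqF.
have wM k w : (k <= N)%N -> weight h (fun i => W (grid h i) w) k <= M.
  move=> kN; apply: le_trans (discrete_weight_le _ _ _ _ _ _) _ => //; first exact: ltW.
  by rewrite ler_expR ler_wpM2r// -Nh ler_wpM2r ?ler_nat// ltW.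
have := weighted_walk h0 C0 gG g1G g2G g2C VL (N1P _ N1N) (N:=N) wM (leqnn N).
rewrite [grid h N]Nh; apply: le_trans.
rewrite -addrA -opprD lerD2l lerN2.
rewrite (_ : N%:R * _ = (N%:R * h) * (M * eta + h * B + 2 * d%:R * M * e1)); last first.
  by rewrite /B; ring.
rewrite Nh.
have : h * (2 * t * B) <= e.
  by have := N2P _ N2N; rewrite -/h mulrA ler_pdivrMr// mul1r.
rewrite -/M; lra.
Qed.

End walk_lower_bound.

(** * From the grid to continuous time *)

Section riemann_sums.
Context {R : realType}.
Local Notation mu := (@lebesgue_measure R).

Lemma integrable_continuous_segment (v : R -> R) (a b : R) : continuous v ->
  mu.-integrable `[a, b] (EFin \o v).
Proof.
move=> cv; apply: continuous_compact_integrable; first exact: segment_compact.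
exact: continuous_subspaceT.
Qed.

Lemma Rintegral_segment_near (v : R -> R) (a b e : R) : continuous v -> a <= b ->
    (forall s, a <= s <= b -> `|v s - v a| <= e) ->
  `|\int[mu]_(s in `]a, b]) v s - (b - a) * v a| <= (b - a) * e.
Proof.
move=> cv ab ve.
have ib (f : R -> R) : continuous f -> mu.-integrable `]a, b] (EFin \o f).
  move=> cf; apply: (integrableS _ _ _ (integrable_continuous_segment a b cf)) => //.
  by apply: subset_itvr; rewrite bnd_simp.
have lb : fine (mu (`]a, b]%classic : set R)) = b - a.
  by rewrite lebesgue_measure_itv /= lte_fin; case: ltP => //= ba; lra.
have cst_int (r : R) : \int[mu]_(s in `]a, b]) r = r * (b - a).
  by rewrite Rintegral_cst// lb.
have up : \int[mu]_(s in `]a, b]) v s <= (v a + e) * (b - a).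
  rewrite -cst_int; apply: le_Rintegral => //; [exact: ib|exact/ib/cst_continuous|].
  move=> s /=; rewrite in_itv /= => /andP[/ltW sa sb].
  by have := ve s; rewrite sa sb => /(_ isT); rewrite ler_norml; lra.
have lo : (v a - e) * (b - a) <= \int[mu]_(s in `]a, b]) v s.
  rewrite -cst_int; apply: le_Rintegral => //; [exact/ib/cst_continuous|exact: ib|].
  move=> s /=; rewrite in_itv /= => /andP[/ltW sa sb].
  by have := ve s; rewrite sa sb => /(_ isT); rewrite ler_norml; lra.
move: up lo; set I := \int[mu]_(s in _) _; clear => up lo.
by rewrite ler_norml; apply/andP; split; lra.
Qed.

Lemma riemann_sum_near (v : R -> R) (h e : R) (k : nat) : continuous v ->
    0 <= h ->
    (forall s s', 0 <= s <= k%:R * h -> `|s' - s| <= h -> `|v s' - v s| <= e) ->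
  `|\int[mu]_(s in `[0, k%:R * h]) v s - h * \sum_(i < k) v (i%:R * h)|
    <= k%:R * h * e.
Proof.
move=> cv h0; elim: k => [|k IH] ve.
  rewrite big_ord0 !mul0r mulr0 subr0.
  by rewrite set_itv1 Rintegral_set1 normr0.
have kh : 0 <= k%:R * h by rewrite mulr_ge0.
have SkE : k.+1%:R * h = k%:R * h + h by rewrite -[k.+1%:R]natr1 mulrDl mul1r.
rewrite big_ord_recr /= mulrDr.
have iv := @integrable_continuous_segment v 0 (k.+1%:R * h) cv.
have := @Rintegral_itvB R v (BLeft 0) (BRight (k.+1%:R * h)) (k%:R * h) iv.
rewrite !bnd_simp SkE => /(_ kh); rewrite lerDl => /(_ h0) IE.
have nk := @Rintegral_segment_near v (k%:R * h) (k%:R * h + h) e cv.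
rewrite lerDl addrAC subrr add0r in nk.
have {}nk := nk h0.
have {}IH : `|\int[mu]_(s in `[0, k%:R * h]) v s -
    h * \sum_(i < k) v (i%:R * h)| <= k%:R * h * e.
  apply: IH => s s' /andP[s0 sk]; apply: ve; rewrite s0 SkE /=; lra.
have {}nk : `|\int[mu]_(s in `]k%:R * h, k%:R * h + h]) v s -
    h * v (k%:R * h)| <= h * e.
  apply: nk => s /andP[s1 s2]; apply: ve; first by rewrite kh SkE lerDl.
  by rewrite ger0_norm; lra.
rewrite -{}IE in nk.
move: IH nk; set I1 := \int[mu]_(s in `[0, k%:R * h]) v s.
set I2 := \int[mu]_(s in `[0, k%:R * h + h]) v s; set S := \sum_(i < k) _.
rewrite mulrDl !ler_norml => /andP[? ?] /andP[? ?]; apply/andP; split; lra.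
Qed.

Lemma riemann_sum_cvg (v : R -> R) (t : R) : continuous v -> 0 < t ->
  t / n.+1%:R * \sum_(i < n.+1) v (i%:R * (t / n.+1%:R)) @[n --> \oo] -->
  \int[mu]_(s in `[0, t]) v s.
Proof.
move=> cv t0; apply/cvgrPdist_le => e e0.
have et0 : 0 < e / t by rewrite divr_gt0.
have [dl dl0 vdl] := compact_uniform_continuity cv (@segment_compact R 0 t) et0.
near=> n.
have n0 : 0 < n.+1%:R :> R by rewrite ltr0n.
have h0 : 0 <= t / n.+1%:R by rewrite divr_ge0// ltW.
have nh : n.+1%:R * (t / n.+1%:R) = t by rewrite mulrC divfK// gt_eqF.
have hdl : t / n.+1%:R < dl.
  rewrite ltr_pdivrMr// mulrC -ltr_pdivrMr//.
  apply: (@lt_trans _ _ n%:R); last by rewrite ltr_nat.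
  by near: n; exact: nbhs_infty_gtr.
have := @riemann_sum_near v (t / n.+1%:R) (e / t) n.+1 cv h0.
rewrite nh (_ : t * (e / t) = e); last by rewrite mulrCA divff ?mulr1// gt_eqF.
apply.
move=> s s' st ss'; apply: ltW; apply: vdl; first by rewrite /= in_itv.
by rewrite /ball /= distrC; exact: le_lt_trans hdl.
Unshelve. all: by end_near.
Qed.

End riemann_sums.

Section path_limit.
Context {R : realType} {d : nat}.
Variables (K : set 'rV[R]_d) (V : 'rV[R]_d -> R) (lambda : R) (g : 'rV[R]_d -> R).
Hypothesis closedK : closed K.
Hypothesis cV : continuous V.
Hypothesis g_off : forall z, ~ K z -> g z = 0.
Variable p : R -> 'rV[R]_d.
Hypothesis cp : {within `[0, +oo[, continuous p}.

(* The path is extended to negative times by reflection, which makes it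
   continuous on the whole line. *)
Let q (s : R) := p `|s|.

Let q_continuous : continuous q.
Proof.
move=> s; have ns : `[0, +oo[%classic `|s| by rewrite /= in_itv /= andbT.
have /subspace_continuousP /(_ _ ns) ps := cp.
apply: cvg_comp ps => A; rewrite /within /= => nA.
have H : nbhs s [set r | `[0, +oo[%classic `|r| -> A `|r|].
  exact: (@norm_continuous _ R^o s _ nA).
change (nbhs s [set r | A `|r|]).
by apply: filterS H => r /=; apply; rewrite in_itv /= andbT.
Qed.

Lemma Rintegral_path_continuous (t : R) :
  continuous (V \o q) /\
  \int[lebesgue_measure]_(s in `[0, t]) V (p s) =
  \int[lebesgue_measure]_(s in `[0, t]) (V \o q) s.
Proof.
split; first by move=> s; apply: continuous_comp; [exact: q_continuous|exact: cV].
apply: eq_Rintegral => s; rewrite inE /= in_itv /= => /andP[s0 _].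
by rewrite /q ger0_norm.
Qed.

(** A path that leaves the closed set [K] before [t] is outside [K] on a time
    interval, which contains a point of every fine enough grid, so the discrete
    weights eventually vanish. The grid points stop before [t], but at time [t]
    the factor [g] takes care of the paths outside [K]. *)
Lemma discrete_weight_cvg (t : R) : 0 < t ->
  discrete_weight K V lambda (t / n.+1%:R) (fun i => p (i%:R * (t / n.+1%:R))) n.+1 *
    g (p t) @[n --> \oo] -->
  chi K p t * expR (lambda * t - \int[lebesgue_measure]_(s in `[0, t]) V (p s)) *
    g (p t).
Proof.
move=> t0.
have [Kt|/g_off ->] := pselect (K (p t)); last first.
  by rewrite mulr0; under eq_fun do rewrite mulr0; exact: cvg_cst.
apply: cvgMr_tmp.
have h0 n : 0 < t / n.+1%:R by rewrite divr_gt0.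
have nh n : n.+1%:R * (t / n.+1%:R) = t by rewrite mulrC divfK// gt_eqF.
have [Kp|/existsNP[s0 /not_implyP[s0t nK]]] :=
    pselect (forall s, 0 <= s <= t -> K (p s)).
  rewrite /chi asboolT// mul1r.
  have [cVq ->] := Rintegral_path_continuous t.
  have E n : discrete_weight K V lambda (t / n.+1%:R)
      (fun i => p (i%:R * (t / n.+1%:R))) n.+1 =
    expR (lambda * t - t / n.+1%:R * \sum_(i < n.+1) (V \o q) (i%:R * (t / n.+1%:R))).
    rewrite /discrete_weight big1 => [|i _]; last first.
      rewrite indicE mem_set//; apply: Kp.
      apply/andP; split; first by rewrite mulr_ge0// ltW.
      by rewrite -[X in _ <= X](nh n) ler_pM2r// ler_nat ltnW.
    rewrite mul1r; congr expR.
    rewrite sumrB mulrBr sumr_const card_ord -[lambda *+ _]mulr_natr; congr (_ - _).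
      by rewrite -[in RHS](nh n); ring.
    congr (_ * _); apply: eq_bigr => i _ /=.
    by rewrite /q ger0_norm// mulr_ge0// ltW.
  under eq_fun do rewrite E.
  apply: (cvg_comp _ expR); last exact: continuous_expR.
  apply: (@cvgB _ R^o); first exact: cvg_cst.
  exact: riemann_sum_cvg.
rewrite /chi asboolF; last by move=> /(_ s0 s0t).
rewrite mul0r.
have s0lt : s0 < t.
  case/andP: s0t => _; rewrite le_eqVlt => /predU1P[s0E|//].
  by case: nK; rewrite s0E.
have s00 : 0 <= s0 by case/andP: s0t.
have : \forall s \near s0, ~ K (q s).
  have oU : open (~` K) by exact: closed_openC.
  have : nbhs (q s0) (~` K).
    by apply: open_nbhs_nbhs; split=> //; rewrite /q ger0_norm.
  exact: q_continuous.
case/nbhs_ballP => r /= r0 rK.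
apply: cvg_near_cst.
near=> n.
have hr : t / n.+1%:R < r.
  rewrite ltr_pdivrMr// mulrC -ltr_pdivrMr//.
  apply: (@lt_trans _ _ n%:R); last by rewrite ltr_nat.
  by near: n; exact: nbhs_infty_gtr.
set h := t / n.+1%:R in hr *.
pose i := Num.truncn (s0 / h).
have sh0 : 0 <= s0 / h by rewrite divr_ge0// ltW// h0.
have /andP[i1 i2] := truncn_itv sh0.
rewrite -/i in i1 i2.
rewrite ler_pdivlMr ?h0// in i1; rewrite ltr_pdivrMr ?h0// in i2.
have iN : (i < n.+1)%N.
  rewrite -(ltr_nat R) -(ltr_pM2r (h0 n)) nh.
  exact: le_lt_trans i1 s0lt.
rewrite /discrete_weight (bigD1 (Ordinal iN))//= indicE memNset ?mul0r//.
have -> : p (i%:R * h) = q (i%:R * h).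
  by rewrite /q ger0_norm// mulr_ge0// ltW// h0.
apply: rK; rewrite /ball /= ger0_norm ?subr_ge0//.
rewrite -natr1 mulrDl mul1r in i2; lra.
Unshelve. all: by end_near.
Qed.

End path_limit.

Section feynman_kac.
Context {disp : measure_display} {T : measurableType disp} {R : realType}.
Variable P : probability T R.
Context {d : nat}.
Variables (x : 'rV[R]_d) (W : R -> T -> 'rV[R]_d).
Hypothesis BW : brownian_motion P x W.
Variables (K : set 'rV[R]_d) (V : 'rV[R]_d -> R) (lambda eta : R).
Hypothesis cV : continuous V.
Hypothesis V_ge0 : forall z, 0 <= V z.
Hypothesis eta_ge0 : 0 <= eta.
Variables (g : 'rV[R]_d -> R) (g1 g2 : 'I_d -> 'rV[R]_d -> R).
Hypothesis sub : compact_subsolution K V lambda eta g g1 g2.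

Lemma feynman_kac_inequality (t : R) : 0 < t ->
  let F w := chi K (W ^~ w) t *
    expR (lambda * t - \int[lebesgue_measure]_(s in `[0, t]) V (W s w)) *
    g (W t w) in
  P.-integrable setT (EFin \o F) /\
  g x <= \int[P]_w F w + expR (t * `|lambda|) * t * eta.
Proof.
move=> t0 F.
have closedK : closed K.
  by apply: compact_closed; [exact: norm_hausdorff|exact: sub_compact sub].
have [G G0 gG] :=
  compact_support_bounded (sub_continuous sub) (sub_compact sub) (sub_support sub).
pose f n w := discrete_weight K V lambda (t / n.+1%:R)
  (fun i => W (i%:R * (t / n.+1%:R)) w) n.+1 * g (W t w).
pose M := expR (t * `|lambda|).
have h0 n : 0 < t / n.+1%:R by rewrite divr_gt0.
have nh n : n.+1%:R * (t / n.+1%:R) = t by rewrite mulrC divfK// gt_eqF.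
have mf n : measurable_fun setT (f n).
  apply: measurable_funM.
    apply: (@measurable_discrete_weight _ _ K V lambda _ T (t / n.+1%:R)
      (fun i w => W (i%:R * (t / n.+1%:R)) w)) => // i _ l.
    by apply: (bm_measurable BW); rewrite mulr_ge0// ltW.
  apply: (measurable_comp_continuous (f := g)) => [j|].
    by apply: (bm_measurable BW); exact: ltW.
  exact: sub_continuous sub.
have fMG n w : `|f n w| <= M * G.
  rewrite normrM ler_pM//.
  rewrite ger0_norm; last exact: discrete_weight_ge0.
  have := discrete_weight_le K lambda (fun i => W (i%:R * (t / n.+1%:R)) w)
    n.+1 V_ge0 (ltW (h0 n)).
  by rewrite nh.
have fF w : f ^~ w @ \oo --> F w.
  by apply: discrete_weight_cvg => //;
    [exact: sub_support sub|exact: (bm_continuous BW)].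
have [|||||iF _ cvgI] := @dominated_convergence _ T R P setT measurableT
    (fun n => EFin \o f n) (EFin \o F) (cst (M * G)%:E).
- by move=> n; apply/measurable_EFinP.
- apply/measurable_EFinP; apply: (measurable_fun_cvg mf) => w _; exact: fF.
- by apply: aeW => w _; apply: cvg_EFin; [exact: nearW|exact: fF].
- exact: Rintegrable_cst.
- by apply: aeW => w n _ /=; rewrite lee_fin.
split=> //.
have {}cvgI : \int[P]_w f n w @[n --> \oo] --> \int[P]_w F w.
  apply: (fine_cvg (f := fun n => (\int[P]_w (f n w)%:E)%E)).
  rewrite fineK//; exact: integrable_fin_num.
apply/ler_addgt0Pr => e e0.
have [N0 N0P] := grid_walk_lower_bound BW cV V_ge0 eta_ge0 sub t0 e0.
have : g x - M * t * eta - e <= \int[P]_w F w.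
  apply: (cvgr_to_ge cvgI); near=> n.
  by apply: N0P; near: n; exact: nbhs_infty_ge.
rewrite -/M; lra.
Unshelve. all: by end_near.
Qed.

End feynman_kac.

(** * A smooth truncation of the modulus *)

Section directional_derivatives.
Context {R : realType} {d : nat}.

Lemma is_derive_lineP (f : 'rV[R]_d -> R) (z : 'rV[R]_d) (j : 'I_d) (l : R) :
  is_derive z (evec R j) f l <->
  is_derive (0 : R) 1 (fun u : R => f (z + u *: evec R j)) l.
Proof.
split=> [df|]; first by apply: is_derive_coordinate_line; rewrite scale0r addr0.
have E : (fun h : R => h^-1 *: (((fun s : R => f (z + s *: evec R j)) \o
      shift 0) (h *: 1) - f (z + 0 *: evec R j))) =
    (fun h : R => h^-1 *: ((f \o shift z) (h *: evec R j) - f z)).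
  apply/funext => h /=; rewrite scale0r addr0.
  have -> : h *: (1 : R) = h by rewrite /GRing.scale /= mulr1.
  by rewrite addr0 [z + _]addrC.
move=> [df fl]; split; first by move: df; rewrite /derivable E.
by rewrite -fl /derive E.
Qed.

Lemma is_derive_outer (G : R -> R) (s : 'rV[R]_d -> R) z (j : 'I_d) (m l : R) :
    is_derive (s z) 1 G m -> is_derive z (evec R j) s l ->
  is_derive z (evec R j) (G \o s) (m * l).
Proof.
move=> dG /is_derive_lineP ds; apply/is_derive_lineP.
apply: (@is_derive1_comp _ G (fun u : R => s (z + u *: evec R j)) 0 m l) => //.
by rewrite scale0r addr0.
Qed.

(** Serves the squared positive part, to avoid gluing two derivatives at [0]. *)
Lemma is_derive_quadratic_bound (f : R -> R) (y l C : R) :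
  (forall h, `|f (h + y) - f y - h * l| <= C * h ^+ 2) -> is_derive y 1 f l.
Proof.
move=> fC.
have : (fun h : R => h^-1 *: ((f \o shift y) (h *: 1) - f y)) @ 0^' --> l.
  apply/cvgrPdist_le => e e0; near=> h.
  have h0 : h != 0 by near: h; exact: nbhs_dnbhs_neq.
  rewrite /= /GRing.scale /= mulr1.
  have -> : l - h^-1 * (f (h + y) - f y) = - (h^-1 * (f (h + y) - f y - h * l)).
    by field.
  rewrite normrN normrM normfV ler_pdivrMl ?normr_gt0//.
  apply: le_trans (fC h) _.
  rewrite -real_normK ?num_real// expr2 mulrA mulrC ler_wpM2l//.
  apply: (@le_trans _ _ ((`|C| + 1) * `|h|)).
    by rewrite ler_wpM2r// (le_trans (ler_norm C))// lerDl.
  rewrite -ler_pdivlMl ?ltr_wpDl// mulrC.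
  near: h; apply: dnbhs0_le; rewrite divr_gt0// ltr_wpDl//.
move=> cf; split; first by apply/cvg_ex; exists l.
exact: cvg_lim.
Unshelve. all: by end_near.
Qed.

Lemma Ck2_partials (Omega : set 'rV[R]_d) (f : 'rV[R]_d -> R) z :
    Ck 2 Omega f -> Omega z -> forall j,
  [/\ is_derive z (evec R j) f (partial j f z),
      is_derive z (evec R j) (partial j f) (partial j (partial j f) z),
      {for z, continuous f}, {for z, continuous (partial j f)} &
      {for z, continuous (partial j (partial j f))}].
Proof.
move=> [cf Df] Oz j; have Oz' : z \in Omega by rewrite inE.
have [df [cf1 /(_ j)[df1 [cf2 _]]]] := Df j.
split; [exact/derivableP/df|exact/derivableP/df1|exact: cf|exact: cf1|exact: cf2].
Qed.

End directional_derivatives.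

Section truncated_modulus.
Context {R : realType}.
Implicit Types (y dl : R).

Definition pos y : R := Num.max y 0.

Lemma pos_ge0 y : 0 <= pos y. Proof. by rewrite le_max lexx orbT. Qed.

Lemma pos_eq0 y : y <= 0 -> pos y = 0. Proof. by move=> y0; apply/max_r. Qed.

Lemma pos_id y : 0 <= y -> pos y = y. Proof. by move=> y0; apply/max_l. Qed.

Lemma pos_mul y : pos y * pos y = y * pos y.
Proof.
have [y0|y0] := leP 0 y; first by rewrite pos_id.
by rewrite pos_eq0 ?mulr0// ltW.
Qed.

Lemma pos_continuous : continuous pos.
Proof.
by move=> y; apply: (@continuous_max _ _ id (cst 0)) => //; exact: cvg_cst.
Qed.

Lemma is_derive_pos_sqr y : is_derive y 1 (fun r => pos r ^+ 2) (2 * pos y).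
Proof.
apply: (@is_derive_quadratic_bound _ _ _ _ 1) => h.
have [y0|y0] := leP 0 y; have [yh0|yh0] := leP 0 (h + y).
- rewrite !pos_id// ler_norml; apply/andP; split; nra.
- rewrite (pos_eq0 (ltW yh0)) pos_id// ler_norml; apply/andP; split; nra.
- rewrite (pos_eq0 (ltW y0)) pos_id// ler_norml; apply/andP; split; nra.
- rewrite (pos_eq0 (ltW y0)) (pos_eq0 (ltW yh0)) ler_norml; apply/andP; split; nra.
Qed.

(** For [y > 0], [shrink dl y] is [y (1 - dl / y)_+ ^ 3]: a convex [C^2]
    approximation of the identity that vanishes for [y <= dl]. The exponent [3]
    is what makes the second derivative continuous at [dl]. *)
Definition shrink dl y := (y - dl) * pos (y - dl) ^+ 2 / y ^+ 2.

Definition shrink1 dl y := pos (y - dl) ^+ 2 * (y + 2 * dl) / y ^+ 3.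

Definition shrink2 dl y := 6 * dl ^+ 2 * pos (y - dl) / y ^+ 4.

Let is_derive_inv_pow n y : y != 0 ->
  is_derive y 1 (fun r : R => (r ^+ n)^-1) (- n%:R * y ^+ n.-1 / y ^+ n ^+ 2).
Proof.
move=> y0; have yn : y ^+ n != 0 by rewrite expf_neq0.
have dX : is_derive y 1 (fun r : R => r ^+ n) (n%:R * y ^+ n.-1).
  rewrite (_ : GRing.exp (R:=R) ^~ n = id ^+ n); last first.
    by apply/funext => r; rewrite exprfctE.
  by apply: is_derive_eq; rewrite /GRing.scale /= mulr1.
have /is_derive_eq := @is_deriveV R (fun r => r ^+ n) y _ 1 yn dX; apply.
rewrite /GRing.scale /=; field; exact: yn.
Qed.

Let is_derive_pos_shift dl y :
  is_derive y 1 (fun r => pos (r - dl) ^+ 2) (2 * pos (y - dl)).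
Proof.
have H : is_derive y 1 (fun r : R => r - dl) 1.
  by apply: is_derive_eq; rewrite subr0.
have := @is_derive1_comp _ (fun r => pos r ^+ 2) _ y _ _ (is_derive_pos_sqr (y - dl)) H.
by rewrite mulr1.
Qed.

Lemma is_derive_shrink dl y : 0 < y -> is_derive y 1 (shrink dl) (shrink1 dl y).
Proof.
move=> y0; have yn0 : y != 0 by rewrite gt_eqF.
have := is_derive_inv_pow 2 yn0; have := is_derive_pos_shift dl y => d1 d2.
have d3 : is_derive y 1 (fun r : R => r - dl) 1.
  by apply: is_derive_eq; rewrite subr0.
have /is_derive_eq := is_deriveM (is_deriveM d3 d1) d2; apply.
rewrite /shrink1 /GRing.scale mulrfctE /= -/(pos _).
have := pos_mul (y - dl); set p := pos (y - dl) => pp.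
rewrite mulr1.
have -> : (y - dl) * (2 * p) = 2 * p ^+ 2 by rewrite expr2 pp; ring.
by field.
Qed.

Lemma is_derive_shrink1 dl y : 0 < y -> is_derive y 1 (shrink1 dl) (shrink2 dl y).
Proof.
move=> y0; have yn0 : y != 0 by rewrite gt_eqF.
have := is_derive_inv_pow 3 yn0; have := is_derive_pos_shift dl y => d1 d2.
have d3 : is_derive y 1 (fun r : R => r + 2 * dl) 1.
  by apply: is_derive_eq; rewrite addr0.
have /is_derive_eq := is_deriveM (is_deriveM d1 d3) d2; apply.
rewrite /shrink2 /GRing.scale mulrfctE /=.
have := pos_mul (y - dl); set p := pos (y - dl) => pp.
have -> : p ^+ 2 = (y - dl) * p by rewrite expr2.
by field.
Qed.

End truncated_modulus.

Section truncation_bounds.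
Context {R : realType}.
Variables (dl : R) (dl_gt0 : 0 < dl).
Implicit Types y : R.

Lemma shrink_small y : y <= dl -> [/\ shrink dl y = 0, shrink1 dl y = 0 & shrink2 dl y = 0].
Proof.
move=> ydl; have p0 : pos (y - dl) = 0 by rewrite pos_eq0// subr_le0.
by rewrite /shrink /shrink1 /shrink2 p0 expr0n /= !(mulr0, mul0r).
Qed.

Lemma shrink1_ge0 y : 0 < y -> 0 <= shrink1 dl y.
Proof.
move=> y0; apply: divr_ge0; last by rewrite exprn_ge0// ltW.
apply: mulr_ge0; first exact: sqr_ge0.
by rewrite addr_ge0 ?mulr_ge0// ltW.
Qed.

Lemma shrink2_ge0 y : 0 < y -> 0 <= shrink2 dl y.
Proof.
move=> y0; apply: divr_ge0; last by rewrite exprn_ge0// ltW.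
by apply: mulr_ge0; [rewrite mulr_ge0// sqr_ge0|exact: pos_ge0].
Qed.

Lemma shrink_bounds y : 0 < y ->
  [/\ 0 <= shrink dl y, y - 3 * dl <= shrink dl y & shrink dl y <= y].
Proof.
move=> y0; have [ydl|dly] := leP y dl.
  by have [-> _ _] := shrink_small ydl; split; lra.
have yn0 : y != 0 by rewrite gt_eqF.
have y2 : 0 < y ^+ 2 by rewrite exprn_gt0.
have t0 : 0 < y - dl by rewrite subr_gt0.
rewrite /shrink (pos_id (ltW t0)) -exprS; split.
- by rewrite divr_ge0 ?sqr_ge0// exprn_ge0// ltW.
- rewrite ler_pdivlMr//.
  have -> : (y - dl) ^+ 3 = (y - 3 * dl) * y ^+ 2 + dl ^+ 2 * (3 * y - dl) by ring.
  by rewrite lerDl mulr_ge0 ?sqr_ge0//; lra.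
- rewrite ler_pdivrMr// -exprS; have dl0 := dl_gt0.
  by apply: lerXn2r; rewrite ?nnegrE; lra.
Qed.

(** The defect is [3 dl (1 - dl / y)_+ ^ 2]. It is what a zeroth order term of a
    differential inequality loses under composition with [shrink dl]: its sign
    suits the potential [V >= 0], its size controls the term in [lambda]. *)
Lemma shrink_defect y : 0 < y ->
  0 <= y * shrink1 dl y - shrink dl y <= 3 * dl.
Proof.
move=> y0; have [ydl|dly] := leP y dl.
  have [-> -> _] := shrink_small ydl; rewrite mulr0 subr0 lexx /=.
  by rewrite mulr_ge0// ltW.
have yn0 : y != 0 by rewrite gt_eqF.
have y2 : 0 < y ^+ 2 by rewrite exprn_gt0.
have t0 : 0 < y - dl by rewrite subr_gt0.
have -> : y * shrink1 dl y - shrink dl y = 3 * dl * ((y - dl) / y) ^+ 2.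
  by rewrite /shrink1 /shrink (pos_id (ltW t0)); field.
have d3 : 0 <= 3 * dl by rewrite mulr_ge0// ltW.
have r0 : 0 <= (y - dl) / y by rewrite divr_ge0// ltW.
have r1 : (y - dl) / y <= 1 by rewrite ler_pdivrMr// mul1r gerBl ltW.
by rewrite mulr_ge0 ?sqr_ge0//= ler_piMr// expr_le1.
Qed.

End truncation_bounds.

(** * Kato's inequality *)

Section modulus.
Context {R : realType} {d : nat}.
Variables (Omega : set 'rV[R]_d) (a b : 'rV[R]_d -> R).
Hypotheses (a_C2 : Ck 2 Omega a) (b_C2 : Ck 2 Omega b).

Definition modulus z := Num.sqrt (a z ^+ 2 + b z ^+ 2).

Definition modulus1 j z :=
  (a z * partial j a z + b z * partial j b z) / modulus z.

Definition modulus2 j z :=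
  (a z * partial j (partial j a) z + b z * partial j (partial j b) z +
   partial j a z ^+ 2 + partial j b z ^+ 2) / modulus z -
  (a z * partial j a z + b z * partial j b z) ^+ 2 / modulus z ^+ 3.

Lemma modulus_sqr z : modulus z ^+ 2 = a z ^+ 2 + b z ^+ 2.
Proof. by rewrite sqr_sqrtr// addr_ge0 ?sqr_ge0. Qed.

Lemma is_derive_modulus z j : Omega z -> 0 < modulus z ->
  is_derive z (evec R j) modulus (modulus1 j z).
Proof.
move=> Oz s0.
have [da _ _ _ _] := Ck2_partials a_C2 Oz j; have [db _ _ _ _] := Ck2_partials b_C2 Oz j.
have q0 : 0 < a z ^+ 2 + b z ^+ 2 by rewrite -sqrtr_gt0.
have dq : is_derive z (evec R j) (fun z => a z ^+ 2 + b z ^+ 2)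
    (2 * (a z * partial j a z + b z * partial j b z)).
  have /is_derive_eq := is_deriveD (is_deriveX 2 da) (is_deriveX 2 db); apply.
  by rewrite /GRing.scale /=; ring.
have := is_derive_outer (is_derive1_sqrt q0) dq.
rewrite -/(modulus z) => /is_derive_eq; apply.
by rewrite /modulus1; field; rewrite gt_eqF.
Qed.

Lemma is_derive_modulus1 z j : Omega z -> 0 < modulus z ->
  is_derive z (evec R j) (modulus1 j) (modulus2 j z).
Proof.
move=> Oz s0; have sn0 : modulus z != 0 by rewrite gt_eqF.
have [da da1 _ _ _] := Ck2_partials a_C2 Oz j; have [db db1 _ _ _] := Ck2_partials b_C2 Oz j.
have dV : is_derive (modulus z) 1 (fun r : R => r^-1) (- modulus z ^- 2).
  have /is_derive_eq := @is_deriveV R id (modulus z) _ 1 sn0 (is_derive_id _ _); apply.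
  by rewrite /GRing.scale /= mulr1.
have dsV := is_derive_outer dV (is_derive_modulus j Oz s0).
have := is_deriveM (is_deriveD (is_deriveM da da1) (is_deriveM db db1)) dsV.
move=> /is_derive_eq; apply.
rewrite /GRing.scale /modulus2 /modulus1 !mulrfctE !addrfctE /=; field.
exact: sn0.
Qed.

Let continuous_pow (f : 'rV[R]_d -> R) n z : {for z, continuous f} ->
  {for z, continuous (fun z => f z ^+ n)}.
Proof.
move=> cf; apply: (@continuous_comp _ _ _ f (fun r => r ^+ n)) => //.
exact: exprn_continuous.
Qed.

Let continuous_add (f f' : 'rV[R]_d -> R) z : {for z, continuous f} ->
  {for z, continuous f'} -> {for z, continuous (fun z => f z + f' z)}.
Proof. exact: (@continuousD R R^o). Qed.

Lemma modulus_continuous z : Omega z -> {for z, continuous modulus}.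
Proof.
move=> Oz; have Oz' : z \in Omega by rewrite inE.
apply: (@continuous_comp _ _ _ (fun z => a z ^+ 2 + b z ^+ 2) Num.sqrt).
  by apply: continuous_add; apply: continuous_pow; [exact: a_C2.1|exact: b_C2.1].
exact: sqrt_continuous.
Qed.

Lemma modulus12_continuous z j : Omega z -> 0 < modulus z ->
  {for z, continuous (modulus1 j)} /\ {for z, continuous (modulus2 j)}.
Proof.
move=> Oz s0; have sn0 : modulus z != 0 by rewrite gt_eqF.
have [_ _ ca ca1 ca2] := Ck2_partials a_C2 Oz j.
have [_ _ cb cb1 cb2] := Ck2_partials b_C2 Oz j.
have cs := modulus_continuous Oz.
have cX f n := @continuous_pow f n z.
have cD f f' := @continuous_add f f' z.
have cM (f f' : 'rV[R]_d -> R) : {for z, continuous f} ->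
    {for z, continuous f'} -> {for z, continuous (fun z => f z * f' z)}.
  exact: continuousM.
have cV (f : 'rV[R]_d -> R) : f z != 0 -> {for z, continuous f} ->
    {for z, continuous (fun z => (f z)^-1)}.
  exact: continuousV.
have cN (f : 'rV[R]_d -> R) : {for z, continuous f} ->
    {for z, continuous (fun z => - f z)}.
  exact: (@continuousN R R^o).
have cN1 := cD _ _ (cM _ _ ca ca1) (cM _ _ cb cb1).
have s3 : modulus z ^+ 3 != 0 by rewrite expf_neq0.
split; first exact: (cM _ _ cN1 (cV _ sn0 cs)).
have cN2 := cD _ _ (cD _ _ (cD _ _ (cM _ _ ca ca2) (cM _ _ cb cb2)) (cX _ 2 ca1))
  (cX _ 2 cb1).
exact: (cD _ _ (cM _ _ cN2 (cV _ sn0 cs))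
  (cN _ (cM _ _ (cX _ 2 cN1) (cV _ s3 (cX _ 3 cs))))).
Qed.

End modulus.

Section kato.
Context {R : realType} {d : nat}.
Implicit Types (psi : 'rV[R]_d -> R[i]) (A : 'rV[R]_d -> 'rV[R]_d) (j : 'I_d).

Lemma cre_momentum A j psi :
  cre (momentum A j psi) = fun z => partial j (cim psi) z - A z 0 j * cre psi z.
Proof.
apply/funext => z; rewrite /cre /cim /momentum /cpartial.
by case: (psi z) => u v /=; ring.
Qed.

Lemma cim_momentum A j psi :
  cim (momentum A j psi) = fun z => - partial j (cre psi) z - A z 0 j * cim psi z.
Proof.
apply/funext => z; rewrite /cre /cim /momentum /cpartial.
by case: (psi z) => u v /=; ring.
Qed.

Lemma Re_sum (F : 'I_d -> R[i]) :
  complex.Re (\sum_j F j) = \sum_j complex.Re (F j).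
Proof. exact: (raddf_sum (@complex.Re R : Rcomplex R -> R)). Qed.

Lemma Im_sum (F : 'I_d -> R[i]) :
  complex.Im (\sum_j F j) = \sum_j complex.Im (F j).
Proof. exact: (raddf_sum (@complex.Im R : Rcomplex R -> R)). Qed.

Lemma half_complex : (2%:R^-1 : R[i]) = (2%:R^-1)%:C%C.
Proof. by rewrite fmorphV rmorph_nat. Qed.

Lemma magnetic_schrodinger_re A V psi z :
  complex.Re (magnetic_schrodinger A V psi z) =
  2^-1 * \sum_j cre (momentum A j (momentum A j psi)) z + V z * cre psi z.
Proof.
rewrite /magnetic_schrodinger half_complex -[in RHS]Re_sum /cre.
by case: (\sum_j _) => u v; case: (psi z) => u' v' /=; ring.
Qed.

Lemma magnetic_schrodinger_im A V psi z :
  complex.Im (magnetic_schrodinger A V psi z) =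
  2^-1 * \sum_j cim (momentum A j (momentum A j psi)) z + V z * cim psi z.
Proof.
rewrite /magnetic_schrodinger half_complex -[in RHS]Im_sum /cim.
by case: (\sum_j _) => u v; case: (psi z) => u' v' /=; ring.
Qed.

Variables (Omega : set 'rV[R]_d) (A : 'rV[R]_d -> 'rV[R]_d) (V : 'rV[R]_d -> R)
  (lambda : R) (phi : 'rV[R]_d -> R[i]).
Hypothesis A_C1 : forall j, Ck 1 setT (fun z => A z 0 j).
Hypothesis ef : dirichlet_eigenfunction Omega A V lambda phi.
Let a := cre phi.
Let b := cim phi.

Let A_facts z j : is_derive z (evec R j) (fun z => A z 0 j)
  (partial j (fun z => A z 0 j) z).
Proof. by apply/derivableP; have [_ /(_ j)[+ _]] := A_C1 j; apply. Qed.

(** The derivatives of [A] produced by expanding [(- i d_j - A_j)^2 phi] multiply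
    [i phi], so they cancel in [kato_inequality]. *)
Lemma cre_momentum2 z j : Omega z ->
  cre (momentum A j (momentum A j phi)) z =
  - partial j (partial j a) z
  - (A z 0 j * partial j b z + b z * partial j (fun z => A z 0 j) z)
  - A z 0 j * (partial j b z - A z 0 j * a z).
Proof.
move=> Oz; rewrite !cre_momentum cim_momentum -/a -/b.
have [da da1 _ _ _] := Ck2_partials (ef_C2_re ef) Oz j.
have [db db1 _ _ _] := Ck2_partials (ef_C2_im ef) Oz j.
have := is_deriveB (is_deriveN da1) (is_deriveM (A_facts z j) db).
by move=> [_ dE]; rewrite {1}/partial dE.
Qed.

Lemma cim_momentum2 z j : Omega z ->
  cim (momentum A j (momentum A j phi)) z =
  - (partial j (partial j b) z
     - (A z 0 j * partial j a z + a z * partial j (fun z => A z 0 j) z))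
  - A z 0 j * (- partial j a z - A z 0 j * b z).
Proof.
move=> Oz; rewrite !cim_momentum cre_momentum -/a -/b.
have [da da1 _ _ _] := Ck2_partials (ef_C2_re ef) Oz j.
have [db db1 _ _ _] := Ck2_partials (ef_C2_im ef) Oz j.
have := is_deriveB db1 (is_deriveM (A_facts z j) da).
by move=> [_ dE]; rewrite {1}/partial dE.
Qed.

(** Kato's inequality for the eigenfunction. The magnetic terms enter through
    [|(- i d_j - A_j) phi|^2] only, which absorbs [(d_j |phi|)^2] by the
    Cauchy-Schwarz inequality. *)
Lemma kato_inequality z : Omega z -> 0 < modulus a b z ->
  (V z - lambda) * modulus a b z <= 2^-1 * \sum_j modulus2 a b j z.
Proof.
move=> Oz s0; have sn0 : modulus a b z != 0 by rewrite gt_eqF.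
have eqn := ef_equation ef Oz.
have Ere : 2^-1 * \sum_j cre (momentum A j (momentum A j phi)) z =
    (lambda - V z) * a z.
  have := congr1 (@complex.Re R) eqn; rewrite magnetic_schrodinger_re.
  have -> : complex.Re (lambda%:C%C * phi z) = lambda * a z.
    by rewrite /a /cre; case: (phi z) => u v /=; ring.
  by rewrite -/a; lra.
have Eim : 2^-1 * \sum_j cim (momentum A j (momentum A j phi)) z =
    (lambda - V z) * b z.
  have := congr1 (@complex.Im R) eqn; rewrite magnetic_schrodinger_im.
  have -> : complex.Im (lambda%:C%C * phi z) = lambda * b z.
    by rewrite /b /cim; case: (phi z) => u v /=; ring.
  by rewrite -/b; lra.
pose B j := - (a z * cre (momentum A j (momentum A j phi)) z +
  b z * cim (momentum A j (momentum A j phi)) z) / modulus a b z.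
have -> : (V z - lambda) * modulus a b z = 2^-1 * \sum_j B j.
  rewrite -mulr_suml sumrN big_split /= -!mulr_sumr.
  move: Ere Eim; set X := \sum_j _; set Y := \sum_j _ => EX EY.
  have -> : X = 2 * (lambda - V z) * a z by lra.
  have -> : Y = 2 * (lambda - V z) * b z by lra.
  have -> : (V z - lambda) * modulus a b z =
      (V z - lambda) * modulus a b z ^+ 2 / modulus a b z by field.
  by rewrite modulus_sqr; field.
rewrite ler_pM2l//; apply: ler_sum => j _; rewrite /B.
rewrite cre_momentum2// cim_momentum2// /modulus2.
have := modulus_sqr a b z.
set S := modulus a b z in s0 sn0 *.
set u := a z; set v := b z; set u1 := partial j a z; set v1 := partial j b z.
set u2 := partial j (partial j a) z; set v2 := partial j (partial j b) z.
set al := A z 0 j; set al1 := partial j (fun z => A z 0 j) z => SE.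
rewrite -subr_ge0.
pose p := (u1 + al * v) ^+ 2 + (v1 - al * u) ^+ 2.
rewrite [X in 0 <= X](_ : _ = (p * S ^+ 2 - (u * u1 + v * v1) ^+ 2) / S ^+ 3).
  apply: divr_ge0; last by rewrite exprn_ge0// ltW.
  rewrite SE [X in 0 <= X](_ : _ = (u * (v1 - al * u) - v * (u1 + al * v)) ^+ 2).
    exact: sqr_ge0.
  by rewrite /p; ring.
have <- : u * u2 + v * v2 + u1 ^+ 2 + v1 ^+ 2 +
    (u * (- u2 - (al * v1 + v * al1) - al * (v1 - al * u)) +
     v * (- (v2 - (al * u1 + u * al1)) - al * (- u1 - al * v))) = p.
  by rewrite /p; ring.
by field.
Qed.

End kato.

(** * The truncated eigenfunction as a subsolution *)

Section truncated_eigenfunction.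
Context {R : realType} {d : nat}.
Variables (Omega : set 'rV[R]_d) (A : 'rV[R]_d -> 'rV[R]_d) (V : 'rV[R]_d -> R)
  (lambda : R) (phi : 'rV[R]_d -> R[i]).
Hypothesis oOmega : open Omega.
Hypothesis bOmega : bounded_set Omega.
Hypothesis A_C1 : forall j : 'I_d, Ck 1 setT (fun z => A z 0 j).
Hypothesis V_ge0 : forall z, 0 <= V z.
Hypothesis ef : dirichlet_eigenfunction Omega A V lambda phi.
Variables (dl : R) (dl_gt0 : 0 < dl).
Let a := cre phi.
Let b := cim phi.
Let S := modulus a b.

Lemma cabsE z : cabs (phi z) = S z.
Proof. by rewrite /S /modulus /a /b /cre /cim; case: (phi z). Qed.

Definition level_set : set 'rV[R]_d := closure Omega `&` [set z | dl <= modulus a b z].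

(** The Dirichlet condition keeps the level set away from the boundary. *)
Lemma level_set_sub : level_set `<=` Omega.
Proof.
move=> z [cz dz]; apply: contrapT => nOz.
have /(ef_boundary ef) phi0 : boundary Omega z.
  by split=> // /interior_subset.
have S0 : S z = 0.
  by rewrite -cabsE phi0 /cabs; exact: ComplexField.Normc.normc0.
by move: dz; rewrite /= -/S S0 leNgt dl_gt0.
Qed.

Lemma level_set_compact : compact level_set.
Proof.
apply: bounded_closed_compact.
  by have [M [Mr MP]] := bOmega; exists M; split=> // r /MP H z /level_set_sub; exact: H.
have cS : {within closure Omega, continuous S}.
  move=> z; apply: (@continuous_comp (subspace (closure Omega)) R R
    (fun z => a z ^+ 2 + b z ^+ 2) Num.sqrt); last exact: sqrt_continuous.
  have cX (f : 'rV[R]_d -> R) : {within closure Omega, continuous f} ->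
      {within closure Omega, continuous (fun z => f z ^+ 2)}.
    move=> cf y; apply: (@continuous_comp (subspace (closure Omega)) R R f
      (fun r => r ^+ 2)); [exact: cf|exact: exprn_continuous].
  apply: (@continuousD R R^o (subspace (closure Omega))).
    exact: (cX a (ef_continuous_re ef)).
  exact: (cX b (ef_continuous_im ef)).
have cU : closed (S @^-1` [set r | dl <= r] : set (subspace (closure Omega))).
  have cge : closed [set r : R | dl <= r] by exact: closed_ge.
  by have /continuous_closedP := cS => /(_ _ cge).
have /closed_subspaceP[U clU UE] := cU.
rewrite (_ : level_set = U `&` closure Omega).
  by apply: closedI => //; exact: closed_closure.
by rewrite UE setIC.
Qed.

Let cut (f : 'rV[R]_d -> R) z := if `[< level_set z >] then f z else 0.

Let cut_in f z : level_set z -> cut f z = f z.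
Proof. by move=> Kz; rewrite /cut asboolT. Qed.

Let cut_out f z : ~ level_set z -> cut f z = 0.
Proof. by move=> Kz; rewrite /cut asboolF. Qed.

(* Near a point of the level set the cut-off is invisible: the functions that
   are cut vanish where [S <= dl]. *)
Let cut_near_in (f : 'rV[R]_d -> R) z : (forall y, S y <= dl -> f y = 0) ->
  level_set z -> \forall y \near z, f y = cut f y.
Proof.
move=> f0 /level_set_sub Oz.
have : nbhs z Omega by exact: open_nbhs_nbhs.
apply: filterS => y Oy; have [/cut_in ->//|nKy] := pselect (level_set y).
rewrite cut_out// f0//; apply/ltW; rewrite ltNge; apply/negP => dy.
by apply: nKy; split=> //; exact: subset_closure.
Qed.

Let cut_near_out (f : 'rV[R]_d -> R) z : ~ level_set z ->
  \forall y \near z, 0 = cut f y.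
Proof.
move=> nKz.
have oK : open (~` level_set).
  apply: closed_openC; apply: compact_closed; last exact: level_set_compact.
  exact: norm_hausdorff.
have : nbhs z (~` level_set) by exact: open_nbhs_nbhs.
by apply: filterS => y /cut_out ->.
Qed.

Let cut_continuous (f : 'rV[R]_d -> R) : (forall y, S y <= dl -> f y = 0) ->
    (forall z, Omega z -> 0 < S z -> {for z, continuous f}) ->
  continuous (cut f).
Proof.
move=> f0 cf z; have [Kz|nKz] := pselect (level_set z).
  have Oz := level_set_sub Kz; have Sz : 0 < S z by exact: lt_le_trans Kz.2.
  rewrite /continuous_at cut_in//; apply: cvg_trans (cf z Oz Sz).
  by apply: near_eq_cvg; [exact: nbhs_filter|exact: (cut_near_in f0 Kz)].
rewrite /continuous_at cut_out//; apply: cvg_near_cst; first exact: nbhs_filter.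
by move: (cut_near_out f nKz); apply: filterS => y ->.
Qed.

Let cut_derive (f f1 : 'rV[R]_d -> R) j : (forall y, S y <= dl -> f y = 0) ->
    (forall z, Omega z -> 0 < S z -> is_derive z (evec R j) f (f1 z)) ->
  forall z, is_derive z (evec R j) (cut f) (cut f1 z).
Proof.
move=> f0 df z; have [Kz|nKz] := pselect (level_set z).
  have Oz := level_set_sub Kz; have Sz : 0 < S z by exact: lt_le_trans Kz.2.
  rewrite cut_in//; apply: near_eq_is_derive (df z Oz Sz).
  exact: (cut_near_in f0 Kz).
rewrite cut_out//; apply: (near_eq_is_derive (f := cst 0)).
exact: cut_near_out.
Qed.

Let h0 z := shrink dl (S z).
Let h1 j z := shrink1 dl (S z) * modulus1 a b j z.
Let h2 j z := shrink2 dl (S z) * modulus1 a b j z ^+ 2 +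
  shrink1 dl (S z) * modulus2 a b j z.

Let h0_small y : S y <= dl -> h0 y = 0.
Proof. by rewrite /h0 => /shrink_small[]. Qed.

Let h1_small j y : S y <= dl -> h1 j y = 0.
Proof. by rewrite /h1 => /shrink_small[_ -> _]; rewrite mul0r. Qed.

Let h2_small j y : S y <= dl -> h2 j y = 0.
Proof. by rewrite /h2 => /shrink_small[_ -> ->]; rewrite !mul0r addr0. Qed.

Let is_derive_continuous (f : R -> R) (y l : R) : is_derive y 1 f l ->
  {for y, continuous f}.
Proof. by move=> [df _]; apply/differentiable_continuous/derivable1_diffP. Qed.

Let shrink2_continuous y : 0 < y -> {for y, continuous (shrink2 dl)}.
Proof.
move=> y0; have yn0 : y ^+ 4 != 0 by rewrite expf_neq0// gt_eqF.
have cp : {for y, continuous (fun r => pos (r - dl))}.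
  apply: (@continuous_comp _ _ _ (fun r => r - dl) pos); last exact: pos_continuous.
  by apply: (@is_derive_continuous _ _ 1); apply: is_derive_eq; rewrite subr0.
have cV : {for y, continuous (fun r : R => (r ^+ 4)^-1)}.
  by apply: continuousV => //; exact: exprn_continuous.
rewrite /shrink2; apply: (@continuousM _ _ (fun r => 6 * dl ^+ 2 * pos (r - dl))
  (fun r => (r ^+ 4)^-1)) => //.
by apply: (@continuousM _ _ (cst (6 * dl ^+ 2))) => //; exact: cst_continuous.
Qed.

Definition truncated_eigenfunction := cut h0.

(** The chain rule gives a term [shrink2 |grad u| ^ 2 >= 0] and [shrink1] times the
    Laplacian of [u], to which Kato's inequality applies; the error [3 |lambda| dl]
    comes from [shrink_defect]. *)
Lemma truncated_eigenfunction_subsolution : exists g1 g2,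
  compact_subsolution level_set V lambda (3 * `|lambda| * dl)
    truncated_eigenfunction g1 g2.
Proof.
have aC2 := ef_C2_re ef; have bC2 := ef_C2_im ef.
have comp_cont (G : R -> R) z : Omega z -> {for S z, continuous G} ->
    {for z, continuous (fun z => G (S z))}.
  move=> Oz cG; apply: (@continuous_comp _ _ _ S G) => //.
  exact: (modulus_continuous aC2 bC2 Oz).
exists (fun j => cut (h1 j)), (fun j => cut (h2 j)); split.
- move=> j; apply: cut_derive => // z Oz Sz.
  exact: is_derive_outer (is_derive_shrink dl Sz) (is_derive_modulus aC2 bC2 j Oz Sz).
- move=> j; apply: cut_derive => [y|z Oz Sz]; first exact: h1_small.
  have d1 := is_derive_outer (is_derive_shrink1 dl Sz) (is_derive_modulus aC2 bC2 j Oz Sz).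
  have /is_derive_eq := is_deriveM d1 (is_derive_modulus1 aC2 bC2 j Oz Sz); apply.
  by rewrite /GRing.scale /h2 /=; ring.
- apply: cut_continuous => // z Oz Sz; apply: (comp_cont (shrink dl) z Oz).
  exact: is_derive_continuous (is_derive_shrink dl Sz).
- move=> j; apply: cut_continuous => [y|z Oz Sz]; first exact: h1_small.
  have [c1 _] := modulus12_continuous aC2 bC2 j Oz Sz.
  apply: (@continuousM _ _ (fun z => shrink1 dl (S z)) (modulus1 a b j)) => //.
  apply: (comp_cont (shrink1 dl) z Oz).
  exact: is_derive_continuous (is_derive_shrink1 dl Sz).
- move=> j; apply: cut_continuous => [y|z Oz Sz]; first exact: h2_small.
  have [c1 c2] := modulus12_continuous aC2 bC2 j Oz Sz.
  have cs1 := comp_cont (shrink1 dl) z Oz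
    (is_derive_continuous (is_derive_shrink1 dl Sz)).
  have cs2 := comp_cont (shrink2 dl) z Oz (shrink2_continuous Sz).
  have c11 := continuousM c1 c1.
  apply: (@continuousD R R^o _ (fun z => shrink2 dl (S z) * modulus1 a b j z ^+ 2)
    (fun z => shrink1 dl (S z) * modulus2 a b j z)).
    exact: (continuousM cs2 c11).
  exact: (continuousM cs1 c2).
- move=> z; rewrite /truncated_eigenfunction /cut; case: ifPn => // /asboolP[_ Sz].
  have S0 : 0 < S z by exact: lt_le_trans Sz.
  by have [] := shrink_bounds dl_gt0 S0.
- exact: level_set_compact.
- by move=> z; exact: cut_out.
- by move=> j z; exact: cut_out.
- by move=> j z; exact: cut_out.
move=> z Kz; have Oz := level_set_sub Kz; have Sz : 0 < S z by exact: lt_le_trans Kz.2.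
rewrite /truncated_eigenfunction cut_in// /h0.
under eq_bigr => j _ do rewrite cut_in//.
rewrite big_split /= -!mulr_sumr mulrDr.
have := kato_inequality A_C1 ef Oz Sz.
have := shrink_defect dl_gt0 Sz; have := shrink1_ge0 dl_gt0 Sz.
have : 0 <= shrink2 dl (S z) * \sum_j modulus1 a b j z ^+ 2.
  apply: mulr_ge0; first exact: shrink2_ge0.
  by apply: sumr_ge0 => j _; exact: sqr_ge0.
rewrite -/a -/b -/S; set X := \sum_j _; set Y := \sum_j _.
set t0 := shrink dl _; set t1 := shrink1 dl _ => X0 t10 /andP[D0 D3] kato.
have H1 : t1 * ((V z - lambda) * S z) <= t1 * (2^-1 * Y) by rewrite ler_wpM2l.
have H2 : 0 <= V z * (S z * t1 - t0) by rewrite mulr_ge0.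
have H3 : lambda * (S z * t1 - t0) <= `|lambda| * (3 * dl).
  by rewrite (le_trans (ler_wpM2r D0 (ler_norm lambda)))// ler_wpM2l.
lra.
Qed.

Lemma truncated_eigenfunction_ge z : Omega z ->
  cabs (phi z) - 3 * dl <= truncated_eigenfunction z.
Proof.
move=> Oz; rewrite cabsE /truncated_eigenfunction.
have [Kz|nKz] := pselect (level_set z).
  have Sz : 0 < S z by exact: lt_le_trans Kz.2.
  by rewrite cut_in//; have [] := shrink_bounds dl_gt0 Sz.
rewrite cut_out// subr_le0; apply: (@le_trans _ _ dl); last first.
  by rewrite ler_peMl// ?ler1n// ltW.
apply/ltW; rewrite ltNge; apply/negP => dz.
by apply: nKz; split=> //; exact: subset_closure.
Qed.

Lemma truncated_eigenfunction_le z : truncated_eigenfunction z <= cabs (phi z).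
Proof.
rewrite cabsE /truncated_eigenfunction; have [Kz|nKz] := pselect (level_set z).
  have Sz : 0 < S z by exact: lt_le_trans Kz.2.
  by rewrite cut_in//; have [] := shrink_bounds dl_gt0 Sz.
by rewrite cut_out// sqrtr_ge0.
Qed.

End truncated_eigenfunction.

(** * Lebesgue null sets are negligible for Brownian motion *)

Section brownian_null_sets.
Context {disp : measure_display} {T : measurableType disp} {R : realType}.
Variable P : probability T R.

(** The integral of a nonnegative function is a supremum over the simple functions
    below it, so monotonicity needs no measurability. This matters for survival in
    an open set, an uncountable intersection of events. *)
Lemma ge0_le_integral_nonmeasurable (f g : T -> \bar R) :
    (forall w, 0 <= f w)%E -> (forall w, f w <= g w)%E ->
  (\int[P]_w f w <= \int[P]_w g w)%E.
Proof.
move=> f0 fg; have g0 w : (0 <= g w)%E by exact: le_trans (f0 w) (fg w).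
rewrite !ge0_integralTE//; apply: ereal_sup_le => _ [h hf <-].
by exists h => // w; exact: le_trans (hf w) (fg w).
Qed.

Lemma normal_prob_segment_le (s u v : R) : 0 < s -> u <= v ->
  (normal_prob 0%R s `[u, v] <= (normal_peak s * (v - u))%:E)%E.
Proof.
move=> s0 uv; rewrite /normal_prob.
apply: (@le_trans _ _ (\int[lebesgue_measure]_(x in `[u, v]) (normal_peak s)%:E))%E.
  apply: ge0_le_integral => //=.
  - by move=> x _; rewrite lee_fin normal_pdf_ge0.
  - apply/measurable_EFinP; apply: measurable_funTS; exact: measurable_normal_pdf.
  - by move=> x _; rewrite lee_fin normal_pdf_ub// gt_eqF.
rewrite integral_cst//= lebesgue_measure_itv /= lte_fin.
case: ltP => [_|vu]; first by rewrite -EFinB -EFinM.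
by rewrite mule0 lee_fin mulr_ge0 ?normal_peak_ge0// subr_ge0.
Qed.

Context {d : nat}.
Variables (x : 'rV[R]_d) (W : R -> T -> 'rV[R]_d).
Hypothesis BW : brownian_motion P x W.
Variables (t : R) (t_gt0 : 0 < t).

Let peak := normal_peak (Num.sqrt t).

Let st_gt0 : 0 < Num.sqrt t. Proof. by rewrite sqrtr_gt0. Qed.

Let mW j : measurable_fun setT (fun w => W t w 0 j).
Proof. by apply: (bm_measurable BW); exact: ltW. Qed.

Definition box_event (u v : 'rV[R]_d) : set T :=
  [set w | forall j, u 0 j <= W t w 0 j <= v 0 j].

Lemma box_event_measurable u v : measurable (box_event u v).
Proof.
rewrite (_ : box_event u v =
    \bigcap_j ((fun w => W t w 0 j) @^-1` `[u 0 j, v 0 j])); last first.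
  by apply/seteqP; split=> [w Hw j _|w Hw j]; have := Hw j; rewrite /= in_itv; exact.
apply: fin_bigcap_measurable => // j _; rewrite -[X in measurable X]setTI.
exact: mW.
Qed.

Lemma box_event_prob (u v : 'rV[R]_d) : (forall j, u 0 j <= v 0 j) ->
  (P (box_event u v) <= (peak ^+ d)%:E * (\prod_(j < d) (v 0 j - u 0 j))%:E)%E.
Proof.
move=> uv.
pose X := @grid_increment _ T R d W t 1.
pose B (ij : 'I_1 * 'I_d) : set R :=
  [set` `[u 0 ij.2 - x 0 ij.2, v 0 ij.2 - x 0 ij.2]].
have XE ij w : X ij w = W t w 0 ij.2 - x 0 ij.2.
  case: ij => i j; rewrite /X /grid_increment /= ord1 /= mul1r mul0r.
  by rewrite (bm_start BW).
have -> : P (box_event u v) = P [set w | forall ij, B ij (X ij w)].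
  congr (P _); apply/seteqP; split=> [w Hw [i j]|w Hw j].
    by have := Hw j; rewrite XE /B /= in_itv /= !lerD2r.
  by have := Hw (ord0, j); rewrite XE /B /= in_itv /= !lerD2r.
have mB ij : measurable (B ij) by rewrite /B.
rewrite (grid_increment_independent BW t_gt0 mB).
pose p ij := fine (P (X ij @^-1` B ij)).
have mXB ij : measurable (X ij @^-1` B ij).
  rewrite -[Y in measurable Y]setTI.
  by apply: (grid_increment_measurable BW t_gt0 (k:=1) ij).
have pE ij : P (X ij @^-1` B ij) = (p ij)%:E.
  by rewrite fineK// fin_num_measure.
under eq_bigr => ij _ do rewrite -/(X ij) pE.
rewrite prodEFin -EFinM lee_fin.
have -> : peak ^+ d * \prod_(j < d) (v 0 j - u 0 j) =
    \prod_(ij : 'I_1 * 'I_d) (peak * (v 0 ij.2 - u 0 ij.2)).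
  rewrite -(pair_bigA _ (fun (i : 'I_1) (j : 'I_d) => peak * (v 0 j - u 0 j))) /=.
  by rewrite big_ord1 big_split /= prodr_const card_ord.
apply: ler_prod => ij _; rewrite fine_ge0//=.
rewrite -lee_fin -pE.
have -> : P (X ij @^-1` B ij) = normal_prob 0 (Num.sqrt t) (B ij).
  exact: (grid_increment_gaussian BW t_gt0 (k:=1) ij (mB ij)).
have -> : v 0 ij.2 - u 0 ij.2 = (v 0 ij.2 - x 0 ij.2) - (u 0 ij.2 - x 0 ij.2) by ring.
by apply: normal_prob_segment_le => //; rewrite lerD2r.
Qed.

(** The density of [W t] is bounded, so Lebesgue null sets are negligible for
    its law. *)
Lemma brownian_null_set (N : set 'rV[R]_d) (e : R) : null_set N -> 0 < e ->
  exists C, [/\ measurable C, forall w, N (W t w) -> C w & (P C <= e%:E)%E].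
Proof.
move=> N0 e0.
have pk0 : 0 < peak ^+ d by rewrite exprn_gt0// normal_peak_gt0// gt_eqF.
have [u [v [uv Nuv vol]]] := N0 (e / peak ^+ d) (divr_gt0 e0 pk0).
exists (\bigcup_n box_event (u n) (v n)); split.
- by apply: bigcupT_measurable => n; exact: box_event_measurable.
- by move=> w /Nuv[n _ H]; exists n.
apply: (@le_trans _ _ (\sum_(0 <= n <oo) P (box_event (u n) (v n))))%E.
  apply: measure_sigma_subadditive => //.
    by move=> n; exact: box_event_measurable.
  by apply: bigcupT_measurable => n; exact: box_event_measurable.
have vol0 n : 0 <= \prod_(j < d) (v n 0 j - u n 0 j).
  by apply: prodr_ge0 => j _; rewrite subr_ge0.
apply: (@le_trans _ _ (\sum_(0 <= n <oo) ((peak ^+ d)%:E *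
    (\prod_(j < d) (v n 0 j - u n 0 j))%:E)))%E.
  apply: lee_nneseries => [n _ //|n _].
  exact: box_event_prob.
rewrite nneseriesZl//; last by move=> n _; rewrite lee_fin.
apply: (@le_trans _ _ ((peak ^+ d)%:E * (e / peak ^+ d)%:E))%E.
  by rewrite lee_pmul2l// lte_fin.
by rewrite -EFinM mulrC divfK// gt_eqF.
Qed.

End brownian_null_sets.

(** * The bound on the eigenfunction *)

Section eigenfunction_bound.
Context {disp : measure_display} {T : measurableType disp} {R : realType}.
Variable P : probability T R.
Context {d : nat}.
Variables (Omega : set 'rV[R]_d) (A : 'rV[R]_d -> 'rV[R]_d) (V : 'rV[R]_d -> R)
  (lambda : R) (phi : 'rV[R]_d -> R[i]).
Hypothesis oOmega : open Omega.
Hypothesis bOmega : bounded_set Omega.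
Hypothesis A_C1 : forall j : 'I_d, Ck 1 setT (fun z => A z 0 j).
Hypothesis cV : continuous V.
Hypothesis V_ge0 : forall z, 0 <= V z.
Hypothesis ef : dirichlet_eigenfunction Omega A V lambda phi.
Variables (x : 'rV[R]_d) (W : R -> T -> 'rV[R]_d).
Hypothesis BW : brownian_motion P x W.
Hypothesis Omega_x : Omega x.
Variables (t : R) (t_gt0 : 0 < t).

Let weight w := expR (lambda * t - \int[lebesgue_measure]_(s in `[0, t]) V (W s w)).

Let survival w := chi Omega (W ^~ w) t * weight w.

Let survival_ge0 w : 0 <= survival w.
Proof. by rewrite mulr_ge0 ?expR_ge0// /chi; case: asboolP. Qed.

(** A path that stays in [K] ends in [Omega], where [g <= |phi| <= M] off the null
    set; the exceptional paths have small probability, and the weight times [g] is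
    bounded on them. *)
Lemma eigenfunction_le_essential_bound (M r : R) : 0 < M ->
    null_set (Omega `&` [set z | M < cabs (phi z)]) ->
    (\int[P]_w (survival w)%:E)%E = r%:E ->
  cabs (phi x) <= M * r.
Proof.
move=> M0 nullM Er.
pose C1 := 3 + expR (t * `|lambda|) * t * (3 * `|lambda|).
have C10 : 0 < C1.
  rewrite ltr_wpDr// mulr_ge0 ?mulr_ge0// ?expR_ge0//; exact: ltW.
apply/ler_addgt0Pr => e e0.
pose dl := e / 2 / C1.
have dl0 : 0 < dl by rewrite !divr_gt0.
have dlC : dl * C1 = e / 2 by rewrite /dl divfK// gt_eqF.
have [g1 [g2 sub]] :=
  truncated_eigenfunction_subsolution oOmega bOmega A_C1 V_ge0 ef dl0.
set K := level_set _ _ _ in sub; set g := truncated_eigenfunction _ _ _ in sub.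
have eta0 : 0 <= 3 * `|lambda| * dl.
  by rewrite mulr_ge0 ?(ltW dl0)// mulr_ge0.
have [iF gF] := feynman_kac_inequality BW cV V_ge0 eta0 sub t_gt0.
set F := fun w => chi K (W ^~ w) t * _ * _ in iF gF.
have [G G0 gG] := compact_support_bounded (sub_continuous sub) (sub_compact sub)
  (sub_support sub).
pose B := expR (t * `|lambda|) * G.
have B0 : 0 <= B by rewrite mulr_ge0 ?expR_ge0.
have chi01 (K' : set 'rV[R]_d) p : 0 <= chi K' p t <= 1.
  by rewrite /chi; case: asboolP; rewrite ?lexx ?ler01.
have F_ge0 w : 0 <= F w.
  rewrite /F !mulr_ge0 ?expR_ge0 ?(sub_ge0 sub)//.
  by case/andP: (chi01 K (W ^~ w)).
have F_le w : F w <= B.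
  rewrite /F /B; apply: ler_pM.
  - by rewrite mulr_ge0 ?expR_ge0//; case/andP: (chi01 K (W ^~ w)).
  - exact: (sub_ge0 sub).
  - case/andP: (chi01 K (W ^~ w)) => c0 c1.
    rewrite -[leRHS]mul1r; apply: ler_pM => //.
    rewrite ler_expR mulrC lerBlDr (le_trans (ler_wpM2l (ltW t_gt0) (ler_norm _)))//.
    by rewrite lerDl Rintegral_ge0.
  - exact: le_trans (ler_norm _) (gG _).
pose e' := e / 2 / (B + 1).
have B1 : 0 < B + 1 by rewrite ltr_wpDl.
have e'0 : 0 < e' by rewrite !divr_gt0.
have Be' : B * e' <= e / 2.
  have : e' * (B + 1) = e / 2 by rewrite /e' divfK// gt_eqF.
  nra.
have [C [mC NC PC]] := brownian_null_set BW t_gt0 nullM e'0.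
(* Off [C], the stopped functional is at most [M] times the survival weight. *)
pose F1 w := M^-1 * (F w * \1_(~` C) w).
have mF : measurable_fun setT F by have /measurable_int/measurable_EFinP := iF.
have mF1 : measurable_fun setT F1.
  by apply: measurable_funM => //; apply: measurable_funM => //;
     apply: measurable_indic; exact: measurableC.
have Mi0 : 0 <= M^-1 by rewrite invr_ge0 ltW.
have F1_ge0 w : 0 <= F1 w.
  by rewrite /F1 indicE; apply: mulr_ge0 => //; apply: mulr_ge0.
have F1_le w : F1 w <= survival w.
  rewrite /F1 indicE; have [Cw|nCw] := pselect (C w).
    by rewrite memNset ?mulr0//=; exact.
  rewrite mem_set// mulr1 ler_pdivrMl//.
  rewrite /F /chi; case: asboolP => [Kw|_]; last first.
    by rewrite !mul0r mulr_ge0// ltW.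
  have Ow s : 0 <= s <= t -> Omega (W s w).
    by move=> /Kw; exact: (level_set_sub ef dl0).
  rewrite /survival /chi asboolT// !mul1r mulrC.
  rewrite ler_wpM2r ?expR_ge0//.
  apply: le_trans (truncated_eigenfunction_le Omega phi dl0 _) _.
  rewrite leNgt; apply/negP => Mphi; apply: nCw; apply: NC; split=> //.
  by apply: Ow; rewrite lexx ltW.
have iF1 : P.-integrable setT (EFin \o F1).
  apply: (@Rintegrable_bounded _ _ _ _ _ (M^-1 * B)) => // w.
  rewrite ger0_norm// /F1 ler_wpM2l// indicE.
  by case: (_ \in _); rewrite ?mulr1 ?mulr0.
have IF1 : \int[P]_w F1 w <= r.
  rewrite -lee_fin -Er /Rintegral fineK; last exact: integrable_fin_num.
  by apply: ge0_le_integral_nonmeasurable => w; rewrite lee_fin.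
have IC : \int[P]_w \1_C w <= e'.
  by rewrite /Rintegral integral_indic// setIT -lee_fin fineK// fin_num_measure.
have iC : P.-integrable setT (EFin \o (\1_C : T -> R)).
  apply: (@Rintegrable_bounded _ _ _ _ _ 1); first exact: measurable_indic.
  by move=> w; rewrite indicE; case: (_ \in _); rewrite ?normr1 ?normr0.
have IF : \int[P]_w F w <= M * r + e / 2.
  apply: (@le_trans _ _ (\int[P]_w (M * F1 w + B * \1_C w))).
    apply: le_Rintegral => //.
      by apply: Rintegrable_add; exact: Rintegrable_scale.
    move=> w _; rewrite /F1 mulrA divff ?gt_eqF// mul1r !indicE in_setC.
    by case: (_ \in _); rewrite /= ?mulr0 ?mulr1 ?add0r ?addr0.
  rewrite RintegralD//; last 2 first.
    exact: Rintegrable_scale.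
    exact: Rintegrable_scale.
  apply: lerD; first by rewrite RintegralZl// ler_pM2l.
  by rewrite RintegralZl// (le_trans _ Be')// ler_wpM2l.
have := truncated_eigenfunction_ge phi dl0 Omega_x.
rewrite -/g => gx.
have : 3 * dl + expR (t * `|lambda|) * t * (3 * `|lambda| * dl) = e / 2.
  by rewrite -dlC /C1; ring.
lra.
Qed.

End eigenfunction_bound.
Theorem theorem2 (R : realType) (d : nat) (d_gt0 : (0 < d)%N)
    (Omega : set 'rV[R]_d)
    (Omega_domain : domain Omega)
    (Omega_bounded : bounded_set Omega)
    (Omega_smooth : smooth_boundary Omega)
    (A : 'rV[R]_d -> 'rV[R]_d)
    (A_C1 : forall j : 'I_d, Ck 1 setT (fun x => A x 0 j))
    (V : 'rV[R]_d -> R)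
    (V_C1 : Ck 1 setT V) (V_ge0 : forall x, 0 <= V x)
    (lambda : R) (phi : 'rV[R]_d -> R[i])
    (phi_eigen : dirichlet_eigenfunction Omega A V lambda phi)
    (x : 'rV[R]_d) (Omega_x : Omega x) (t : R) (t_gt0 : 0 < t)
    (disp : measure_display) (T : measurableType disp) (P : probability T R)
    (W : R -> T -> 'rV[R]_d) (W_brownian : brownian_motion P x W) :
  ((cabs (phi x))%:E / Linfty_norm Omega phi <=
    'E_P[fun w : T => (chi Omega (fun s => W s w) t *
       expR (lambda * t - \int[lebesgue_measure]_(s in `[0%R, t]) V (W s w)))%R])%E.
Proof.
have oOmega : open Omega by case: Omega_domain.
have cV : continuous V by move=> z; have [+ _] := V_C1; apply; rewrite inE.
rewrite unlock; set E := (\int[P]_w _)%E; set L := Linfty_norm Omega phi.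
have E0 : (0 <= E)%E.
  apply: integral_ge0 => w _; rewrite lee_fin mulr_ge0 ?expR_ge0//.
  by rewrite /chi; case: asboolP.
have L0 : (0 <= L)%E by apply: le_ereal_inf_tmp => _ [M [M0 _] <-]; rewrite lee_fin.
have [Ey|[r Er]] : E = +oo%E \/ exists r, E = r%:E.
  by case: (E) E0 => [r|_|//]; [right; exists r|left].
  by rewrite Ey leey.
have r0 : 0 <= r by rewrite -lee_fin -Er.
have key M : (L < M%:E)%E -> cabs (phi x) <= M * r.
  move=> /ereal_inf_lt[_ [N [N0 nullN] <-]]; rewrite lte_fin => NM.
  apply: (eigenfunction_le_essential_bound oOmega Omega_bounded A_C1 cV V_ge0
    phi_eigen W_brownian Omega_x t_gt0 _ _ Er); first exact: le_lt_trans NM.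
  move=> e /nullN[u [v [uv sub vol]]]; exists u, v; split=> //.
  apply: subset_trans sub => z [Oz Mz]; split=> //=.
  exact: lt_trans NM Mz.
rewrite Er; case: (L) L0 key => [l|_ _|//]; last by rewrite invey mule0.
rewrite lee_fin => l0 key.
have lr : cabs (phi x) <= l * r.
  apply/ler_addgt0Pr => e e0.
  have r1 : 0 < r + 1 by rewrite ltr_wpDl.
  have e'0 : 0 < e / (r + 1) by rewrite divr_gt0.
  have := key (l + e / (r + 1)); rewrite lte_fin ltrDl => /(_ e'0).
  have : e / (r + 1) * (r + 1) = e by rewrite divfK// gt_eqF.
  nra.
have c0 : 0 <= cabs (phi x) by rewrite cabsE sqrtr_ge0.
(* If the norm is [0] the quotient is read as [0 / 0 = 0 * +oo = 0]. *)
have [l00|ln0] := eqVneq l 0.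
  have -> : cabs (phi x) = 0.
    by apply/eqP; rewrite eq_le c0 andbT (le_trans lr)// l00 mul0r.
  by rewrite mul0e lee_fin.
rewrite inver (negPf ln0) -EFinM lee_fin ler_pdivrMr ?(mulrC r)//.
by rewrite lt_neqAle eq_sym ln0.
Qed.
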